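(* Let $g:\mathbb{R}\to\mathbb{R}$ be Lipschitz continuous, $\mathbb{Z}$-periodic and such that $g(y)>0$ for every $y$, let $0<\alpha<1$, and let $u_0:\mathbb{R}^n\to\mathbb{R}$ be $u_0(x)=-C|x|$ with $C>0$. For $\varepsilon>0$ let $u^\varepsilon_\alpha$ be the solution to $$u^\varepsilon_t-\varepsilon^\alpha\Delta u^\varepsilon-g\left(\frac{u^\varepsilon}{\varepsilon}\right)=0\ \text{ in }\mathbb{R}^n\times(0,+\infty),\qquad u^\varepsilon(x,0)=u_0(x)\ \text{ in }\mathbb{R}^n.$$ Then, as $\varepsilon\to0$, $u^\varepsilon_\alpha$ converges locally uniformly to the function $$v(x,t)=\min\left[u_0(x)+t\int_0^1 g(s)\,ds,\ t\left(\int_0^1\frac1{g(s)}\,ds\right)^{-1}\right].$$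
   Context: $\Delta$ is the Laplacian in $x$. The solution $u^\varepsilon_\alpha$ is the unique (classical) solution, of class $C^{2+\gamma,1+\gamma/2}$ for all $\gamma\in(0,1)$. Locally uniform convergence is on $\mathbb{R}^n\times[0,+\infty)$. *)

(* Defs.v *)
From HB Require Import structures.
From mathcomp Require Export all_boot all_order all_algebra.
From mathcomp Require Export all_classical all_reals all_analysis.

Set Implicit Arguments.
Unset Strict Implicit.
Unset Printing Implicit Defensive.

Import Order.TTheory GRing.Theory Num.Theory.
Import numFieldNormedType.Exports.

Local Open Scope classical_set_scope.
Local Open Scope ring_scope.

(* The norm `|x| on row vectors is the sup norm, hence this definition. *)
Definition enorm (R : realType) (n : nat) (x : 'rV[R]_n) : R :=
  Num.sqrt (\sum_(i < n) x 0 i ^+ 2).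

Definition partial (R : realType) (n : nat) (i : 'I_n) (f : 'rV[R]_n -> R) :
    'rV[R]_n -> R :=
  'D_(delta_mx 0 i) f.

Definition laplacian (R : realType) (n : nat) (f : 'rV[R]_n -> R) :
    'rV[R]_n -> R :=
  fun x => \sum_(i < n) partial i (partial i f) x.

Definition closed_half_space (R : realType) (n : nat) : set ('rV[R]_n * R) :=
  [set p | 0 <= p.2].

Definition open_half_space (R : realType) (n : nat) : set ('rV[R]_n * R) :=
  [set p | 0 < p.2].

(* f is of class C^{gamma,gamma/2} on every compact subset of R^n x (0,+oo). *)
Definition parabolic_holder (R : realType) (n : nat) (gamma : R)
    (f : 'rV[R]_n -> R -> R) : Prop :=
  forall K : set ('rV[R]_n * R), compact K -> K `<=` @open_half_space R n ->
  exists H : R, forall p q : 'rV[R]_n * R, K p -> K q ->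
    `|f p.1 p.2 - f q.1 q.2| <=
      H * (enorm (p.1 - q.1) `^ gamma + `|p.2 - q.2| `^ (gamma / 2)).

(* u is of class C^{2+gamma,1+gamma/2}, locally in R^n x (0,+oo): regularity
   up to t = 0 is not to be expected, as the initial datum is only Lipschitz. *)
Definition parabolic_C2holder (R : realType) (n : nat) (gamma : R)
    (u : 'rV[R]_n -> R -> R) : Prop :=
  [/\ forall x t, 0 < t ->
        [/\ derivable (u x) t 1,
            forall i, derivable (u ^~ t) x (delta_mx 0 i)
          & forall i j, derivable (partial i (u ^~ t)) x (delta_mx 0 j)],
      {in @open_half_space R n, continuous (fun p => u p.1 p.2)},
      forall i, {in @open_half_space R n,
        continuous (fun p => partial i (u ^~ p.2) p.1)},
      parabolic_holder gamma (fun x t => (u x)^`()%classic t)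
    & forall i j,
        parabolic_holder gamma (fun x t => partial j (partial i (u ^~ t)) x)].

(* The classical solution of
     u_t - eps^alpha Delta u - g(u/eps) = 0 in R^n x (0,+oo),   u(.,0) = u0.
   The last clause selects the class in which it is unique: with no growth
   condition at infinity, uniqueness fails already for the heat equation
   (Tychonoff). The growth is that of a Lipschitz initial datum. *)
Definition is_solution (R : realType) (n : nat) (g : R -> R) (alpha eps : R)
    (u0 : 'rV[R]_n -> R) (u : 'rV[R]_n -> R -> R) : Prop :=
  [/\ forall gamma, 0 < gamma < 1 -> parabolic_C2holder gamma u,
      {within @closed_half_space R n, continuous (fun p => u p.1 p.2)},
      forall x t, 0 < t ->
        (u x)^`()%classic t - eps `^ alpha * laplacian (u ^~ t) x - g (u x t / eps) = 0,
      forall x, u x 0 = u0 x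
    & forall T, 0 < T -> exists M, forall x t, 0 <= t <= T ->
        `|u x t| <= M * (1 + enorm x)].

(* Locally uniform convergence on R^n x [0,+oo), a locally compact space:
   uniform convergence on each compact subset. *)
Definition cvg_locally_uniformly (R : realType) (n : nat)
    (u : R -> 'rV[R]_n -> R -> R) (F : set_system R) (v : 'rV[R]_n -> R -> R) :
    Prop :=
  forall K : set ('rV[R]_n * R),
    compact K -> K `<=` @closed_half_space R n ->
    {uniform K, (fun eps (p : 'rV[R]_n * R) => u eps p.1 p.2) @ F -->
                (fun p => v p.1 p.2)}.

(* Main.v *)
Require Import Defs.
From mathcomp Require Import ring lra.
Import Order.TTheory GRing.Theory Num.Theory.
Import numFieldNormedType.Exports.

Local Open Scope classical_set_scope.
Local Open Scope ring_scope.
Set Implicit Arguments.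
Unset Strict Implicit.
Unset Printing Implicit Defensive.

(** On the scale of its phase u / eps, a solution with gradient p diffuses with
    the coefficient kap = eps `^ (alpha - 1) |p| ^ 2. A pulsating wave with this
    coefficient has an effective speed c, given by the periodic profile equation
    kap q' + g / q = c normalised by the mean of 1 / q being 1 (corrector_exists).
    The speed always lies between the harmonic and the arithmetic mean of g
    (corrector_harm_le, corrector_arith); it tends to the arithmetic mean as kap
    tends to infinity and to the harmonic mean as kap tends to 0. As alpha < 1,
    kap tends to infinity wherever p is not 0. In the limit the front therefore
    moves with the arithmetic mean where its gradient does not vanish and with
    the harmonic mean where it does. Started from a cone, the
    solution of the limit problem is a cone rising at the arithmetic speed, cut off
    by a plateau rising at the harmonic speed.

    The oscillations are removed by a change of unknown: if Gam is a primitive of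
    1 / q, then U = eps Gam (u / eps) is within eps of u and solves
    U_t = eps `^ alpha Lap U + eps `^ (alpha - 1) |grad U| ^ 2 q' + g / q, where the last
    two terms add up to c as long as |grad U| is the slope that kap was computed
    from. The maximum principle can then be applied to U with quadratic test
    functions (touching, comparison).

    The upper bound compares U with affine functions: constants in space for the
    plateau (upper_harmonic), and all slopes below C for the cone
    (upper_arithmetic). The gradient of an affine function being constant, a single
    corrector serves each of them, and the error is 2 eps.

    For the lower bound the limit is a minimum, not a maximum, of simple
    functions, so that a single test function must cross from the cone to the
    plateau and all slopes occur, in particular those with kap of order 1. By
    doubling of variables, a paraboloid touching u from below has a gradient and
    a time slope (p, tau) taken from the superdifferential of the limit, where
    tau <= A and tau <= h + |p| (A - h) / C for the arithmetic mean A and the harmonic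
    mean h (profile_superdifferential). If the limit is first lowered by a small
    multiple of the time, then for small eps and whatever the size of |p|, tau lies
    below the speed of the corrector with kap = eps `^ (alpha - 1) |p| ^ 2 (speed_gap),
    which contradicts the equation of U (lower_bound). The slope of the test function is
    only nearly constant around the contact point; the errors are controlled by
    the two bounds on q', one uniform in kap and one of order 1 / kap. *)

(** * Calculus on the line *)

Section Calculus.
Context {R : realType}.
Implicit Types (f g F G : R -> R) (x a b c : R).

Lemma is_derive1_cont f x (d : R) : is_derive x 1 f d -> {for x, continuous f}.
Proof.
move=> df; apply: differentiable_continuous; apply/derivable1_diffP.
exact: ex_derive.
Qed.

Lemma is_derive_MVT f (f' : R -> R) a b :
  (forall x, is_derive x 1 f (f' x)) -> a <= b ->
  exists2 c, a <= c <= b & f b - f a = f' c * (b - a).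
Proof.
move=> df ab; have [|c] := @MVT_segment R f f' a b ab (fun x _ => df x).
  by apply: continuous_subspaceT => x; exact: is_derive1_cont (df x).
by rewrite in_itv /= => cab e; exists c.
Qed.

Lemma le_is_derive f g (f' g' : R -> R) a b :
  (forall x, is_derive x 1 f (f' x)) -> (forall x, is_derive x 1 g (g' x)) ->
  (forall x, f' x <= g' x) -> a <= b -> f b - f a <= g b - g a.
Proof.
move=> df dg le ab; rewrite -subr_ge0.
have dh x : is_derive x 1 (g - f) (g' x - f' x).
  exact: is_deriveB.
have [c _] := is_derive_MVT dh ab.
have -> : g b - g a - (f b - f a) = (g - f) b - (g - f) a.
  by rewrite -![(_ - _ : _ -> _) _]/(_ - _); ring.
by move=> ->; rewrite mulr_ge0 ?subr_ge0.
Qed.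

Lemma eq_is_derive f g (f' : R -> R) a b :
  (forall x, is_derive x 1 f (f' x)) -> (forall x, is_derive x 1 g (f' x)) ->
  f b - f a = g b - g a.
Proof.
move=> df dg; wlog ab : a b / a <= b => [H|].
  by have [/H//|/ltW/H e] := leP a b; lra.
by apply/eqP; rewrite eq_le !(@le_is_derive _ _ f' f').
Qed.

(** The integrals from different negative base points differ by constants;
    anchoring each of them at 0 makes them agree, and near any given point a
    single base point serves. *)
Lemma antiderivative f : continuous f ->
  exists F, forall x, is_derive x 1 F (f x).
Proof.
move=> cf.
pose I (a x : R) : R := (\int[lebesgue_measure]_(t in `[a, x]) f t)%R.
have dI a x : a < x -> is_derive x 1 (I a) (f x).
  move=> ax; have xx1 : x < x + 1 by rewrite ltrDl.
  have fint : lebesgue_measure.-integrable `[a, x + 1] (EFin \o f).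
    apply: continuous_compact_integrable; first exact: segment_compact.
    exact: continuous_subspaceT.
  have [d e] := continuous_FTC1_closed xx1 fint ax (cf x).
  by apply: DeriveDef; [exact: d|rewrite -derive1E; exact: e].
pose J a x : R := I a x - I a 0.
have dJ a x : a < x -> is_derive x 1 (J a) (f x).
  move=> ax; have := dI a x ax => ?.
  by apply: is_derive_eq; rewrite subr0.
have J0 a : J a 0 = 0 by rewrite /J subrr.
have JE a b x : a < 0 -> b < 0 -> a < x -> b < x -> J a x = J b x.
  move=> a0 b0 ax bx.
  pose m := Order.min 0 x; pose M := Order.max 0 x.
  have am : a < m by rewrite lt_min a0.
  have bm : b < m by rewrite lt_min b0.
  have mM : m <= M by rewrite ge_min le_max lexx.
  pose h := J a - J b.
  have dh y : m <= y -> is_derive y 1 h 0.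
    move=> my; have := dJ a y (lt_le_trans am my) => ?.
    have := dJ b y (lt_le_trans bm my) => ?.
    by apply: is_derive_eq; rewrite subrr.
  have [c _ hc] : exists2 c, c \in `[m, M]%R & h M - h m = 0 * (M - m).
    apply: (@MVT_segment R h (fun=> 0)) => //.
      by move=> y; rewrite in_itv/= => /andP[/ltW/dh].
    apply: derivable_within_continuous => y; rewrite in_itv/= => /andP[/dh ? _].
    exact: ex_derive.
  have h0 : h 0 = 0 by rewrite /h -[(_ - _ : _ -> _) _]/(_ - _) !J0 subrr.
  have : h x = 0.
    move: hc; rewrite mul0r /m /M; case: (leP 0 x) => _ e; lra.
  by rewrite /h -[(_ - _ : _ -> _) _]/(_ - _) => /eqP; rewrite subr_eq0 => /eqP.
exists (fun x => J (- (`|x| + 1)) x) => x.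
have xlt : - (`|x| + 2) < x.
  rewrite ltrNl (le_lt_trans (ler_norm _))// normrN; lra.
have := dJ _ _ xlt => H.
apply: near_eq_is_derive H; exists 1 => //= y.
rewrite /= distrC => yx1.
have yx : `|y| < `|x| + 1.
  by rewrite -ltrBlDl (le_lt_trans _ yx1)// lerB_dist.
apply: JE.
- by rewrite oppr_lt0 ltr_pwDr.
- by rewrite oppr_lt0 ltr_pwDr.
- rewrite ltrNl (le_lt_trans (ler_norm _))// normrN; lra.
- rewrite ltrNl (le_lt_trans (ler_norm _))// normrN; lra.
Qed.

Lemma Rintegral_antiderivative f F : continuous f ->
  (forall x, is_derive x 1 F (f x)) ->
  (\int[lebesgue_measure]_(t in `[0%R, 1%R]) f t)%R = F 1 - F 0.
Proof.
move=> cf dF; rewrite /Rintegral (@continuous_FTC2 R f F)//.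
- exact: continuous_subspaceT.
- split => [x _| |].
  + exact: ex_derive.
  + by apply: cvg_at_right_filter; exact: (is_derive1_cont (dF 0)).
  + by apply: cvg_at_left_filter; exact: (is_derive1_cont (dF 1)).
- by move=> x _; rewrite derive1E; exact: derive_val.
Qed.

Definition periodic f := forall x (k : int), f (x + k%:~R) = f x.

Lemma periodic_of_step f : (forall x, f (x + 1) = f x) -> periodic f.
Proof.
move=> f1; have fn (k : nat) : forall x, f (x + k%:R) = f x.
  elim: k => [|k IH] x; first by rewrite addr0.
  by rewrite -natr1 addrA f1 IH.
move=> x [k|k]; first exact: fn.
by rewrite NegzE mulrNz -(fn k.+1 (x - _)) subrK.
Qed.

Lemma periodic_argmax f : continuous f -> periodic f ->
  exists c, forall x, f x <= f c.
Proof.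
move=> cf pf; have [|c _ fc] := @EVT_max R f 0 1 ler01.
  exact: continuous_subspaceT.
exists c => x; rewrite -(pf x (- Num.floor x)) mulrNz; apply: fc.
rewrite in_itv/= -/(x - _).
by have /andP[] := floor_itv x; rewrite intrD; lra.
Qed.

Lemma is_derive_translate f (s x d : R) : is_derive (x + s) 1 f d ->
  is_derive x 1 (fun t => f (t + s)) d.
Proof.
move=> df; have -> : (fun t => f (t + s)) = f \o (fun t => t + s) by [].
rewrite -[d]mulr1; apply: is_derive1_comp.
by apply: is_derive_eq; rewrite addr0.
Qed.

(** All the tests at extrema below are read off from the sign of difference
    quotients. *)
Lemma is_derive_pos_quotient f c (d : R) : is_derive c 1 f d -> 0 < d ->
  exists2 e, 0 < e &
    forall h, h != 0 -> `|h| < e -> 0 < h^-1 * (f (c + h) - f c).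
Proof.
move=> [df dE] d0; have : (fun h => h^-1 *: ((f \o shift c) h%:A - f c)) @ 0^' --> d.
  by rewrite -dE; exact: df.
move=> /cvgrPdist_lt /(_ _ d0)[e /= e0 H].
exists e => // h h0 he; have := H h; rewrite /= sub0r normrN => /(_ he h0).
rewrite [_%:A]mulr1 [h + c]addrC => /(le_lt_trans (ler_norm _)).
by rewrite ltrBlDr ltrDl.
Qed.

Lemma is_derive_le0_left f c (d : R) : 0 < c -> is_derive c 1 f d ->
  (forall x, 0 <= x <= c -> f c <= f x) -> d <= 0.
Proof.
move=> c0 df fc; rewrite leNgt; apply/negP => d0.
have [e e0 H] := is_derive_pos_quotient df d0.
pose h := Num.min (e / 2) c.
have h0 : 0 < h by rewrite lt_min c0 divr_gt0.
have he : h < e by rewrite gt_min ltr_pdivrMr// ltr_pMr// ltr1n.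
have hc : h <= c by rewrite ge_min lexx orbT.
have := H (- h); rewrite normrN gtr0_norm// oppr_eq0 gt_eqF// => /(_ isT he).
rewrite invrN mulNr oppr_gt0 pmulr_rlt0 ?invr_gt0// subr_lt0.
by apply/negP; rewrite -leNgt; apply: fc; lra.
Qed.

Lemma is_derive_min f c (d : R) : is_derive c 1 f d ->
  (forall x, f c <= f x) -> d = 0.
Proof.
move=> df fc.
have [d0|d0|//] := ltrgt0P d.
  have [e e0 H] := is_derive_pos_quotient df d0.
  have := H (- (e / 2)); rewrite normrN gtr0_norm ?divr_gt0// oppr_eq0.
  rewrite gt_eqF ?divr_gt0// => /(_ isT) H'.
  have /H' : e / 2 < e by rewrite ltr_pdivrMr// ltr_pMr// ltr1n.
  rewrite invrN mulNr oppr_gt0 pmulr_rlt0 ?invr_gt0 ?divr_gt0// subr_lt0.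
  by rewrite ltNge fc.
have dN : is_derive c 1 (- f) (- d) by exact: is_deriveN.
have := d0; rewrite -oppr_gt0 => /(is_derive_pos_quotient dN)[e e0 H].
have := H (e / 2); rewrite gtr0_norm ?divr_gt0//.
rewrite gt_eqF ?divr_gt0// => /(_ isT) H'.
have /H' : e / 2 < e by rewrite ltr_pdivrMr// ltr_pMr// ltr1n.
rewrite pmulr_rgt0 ?invr_gt0 ?divr_gt0// -![(- f) _]/(- f _).
by rewrite opprK addrC subr_gt0 ltNge fc.
Qed.

Lemma is_derive_max f c (d : R) : is_derive c 1 f d ->
  (forall x, f x <= f c) -> d = 0.
Proof.
move=> df fc; apply/eqP; rewrite -oppr_eq0; apply/eqP.
have dN : is_derive c 1 (- f) (- d) by exact: is_deriveN.
apply: (is_derive_min dN) => x.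
by rewrite -![(- f) _]/(- f _) lerN2.
Qed.

(** If the second derivative were negative, the first one would be negative
    just to the right of the critical point, and f would drop below its
    minimum. *)
Lemma is_derive2_min f f' c (d : R) : (forall x, is_derive x 1 f (f' x)) ->
  is_derive c 1 f' d -> (forall x, f c <= f x) -> 0 <= d.
Proof.
move=> df ddf fc; rewrite leNgt; apply/negP => d0.
have f'c : f' c = 0 := is_derive_min (df c) fc.
have dN : is_derive c 1 (- f') (- d) by exact: is_deriveN.
have := d0; rewrite -oppr_gt0 => /(is_derive_pos_quotient dN)[e e0 H].
have [||x] := @MVT R f f' c (c + e / 2).
- by rewrite ltrDl divr_gt0.
- by apply: continuous_subspaceT => x; exact: is_derive1_cont (df x).
rewrite in_itv/= => /andP[cx xe] E.
have := H (x - c); rewrite subr_eq0 gt_eqF// gtr0_norm ?subr_gt0//.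
have -> : c + (x - c) = x by ring.
rewrite -![(- f') _]/(- f' _) f'c oppr0 subr0 mulrN oppr_gt0.
move=> /(_ isT) H'; have /H' : x - c < e by lra.
rewrite pmulr_rlt0 ?invr_gt0 ?subr_gt0// => f'x.
have := fc (c + e / 2); rewrite -subr_ge0 E leNgt => /negP; apply.
by rewrite pmulr_llt0//; lra.
Qed.

End Calculus.

(** * Periodic solutions of the profile equation *)

Section PeriodicLinear.
Context {R : realType}.
Implicit Types (f p q : R -> R) (x y : R).

Lemma lipschitz_cont f (K : R) :
  (forall x y, `|f x - f y| <= K * `|x - y|) -> continuous f.
Proof.
move=> fK x; apply/cvgrPdist_lt => e e0.
have K1 : 0 < `|K| + 1 by rewrite ltr_wpDl.
exists (e / (`|K| + 1)) => /=; first by rewrite divr_gt0.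
move=> y /= xy; rewrite (le_lt_trans (fK _ _))//.
rewrite ltr_pdivlMr// mulrC in xy; apply: le_lt_trans xy.
by rewrite ler_wpM2r// (le_trans (ler_norm _))// lerDl.
Qed.

Lemma lipschitz_is_derive f (f' : R -> R) (K : R) :
  (forall x, is_derive x 1 f (f' x)) -> (forall x, `|f' x| <= K) ->
  forall x y, `|f x - f y| <= K * `|x - y|.
Proof.
move=> df fK x y; wlog yx : x y / y <= x => [H|].
  have [/H//|/ltW/H] := leP y x; by rewrite distrC [`|y - x|]distrC.
have [c _ ->] := is_derive_MVT df yx.
by rewrite normrM ler_wpM2r.
Qed.

Lemma is_derive_expRM (m x : R) :
  is_derive x 1 (fun y => expR (m * y)) (m * expR (m * x)).
Proof.
have -> : (fun y => expR (m * y)) = expR \o ( *%R m) by [].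
rewrite [m * expR _]mulrC; apply: is_derive1_comp.
by apply: is_derive_eq; rewrite [_%:A]mulr1.
Qed.

(** Variation of constants: for a primitive P of exp (- m x) f / kap, with
    m = lam / kap, the function exp (m x) (K - P) solves the equation for every
    K, and p 1 = p 0 determines K because exp m differs from 1. *)
Lemma linear_periodic_solution (kap lam : R) f : 0 < kap -> 0 < lam ->
  continuous f -> periodic f ->
  exists2 p, periodic p & forall x, is_derive x 1 p ((lam * p x - f x) / kap).
Proof.
move=> kap0 lam0 cf pf; pose m := lam / kap.
have m0 : 0 < m by rewrite divr_gt0.
have cE : continuous (fun x => expR (- m * x) * f x / kap).
  move=> x; apply: cvgMl; apply: cvgM; last exact: cf.
  exact: (is_derive1_cont (is_derive_expRM (- m) x)).
have [P dP] := antiderivative cE.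
have em1 : expR m - 1 != 0.
  by rewrite subr_eq0 gt_eqF// -[X in X < _](expR0 R) ltr_expR.
pose K := (expR m * P 1 - P 0) / (expR m - 1).
pose p x := expR (m * x) * (K - P x).
have dp x : is_derive x 1 p ((lam * p x - f x) / kap).
  have := is_derive_expRM m x => ?; have := dP x => ?.
  apply: is_derive_eq; rewrite /GRing.scale/= /p add0r mul1r.
  have : expR (m * x) * expR (- m * x) = 1.
    by rewrite -expRD mulNr subrr expR0.
  have -> : m = lam / kap by [].
  move=> e; transitivity (lam / kap * (expR (lam / kap * x) * (K - P x)) -
    (expR (lam / kap * x) * expR (- (lam / kap) * x)) * f x / kap); first by ring.
  by rewrite e; field; rewrite gt_eqF.
exists p => //; apply: periodic_of_step => x.
(* The increment p (y + 1) - p y solves the homogeneous equation. *)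
pose w y := expR (- m * y) * (p (y + 1) - p y).
have dw y : is_derive y 1 w 0.
  have := is_derive_expRM (- m) y => ?; have := dp y => ?.
  have ? : is_derive y 1 (fun y => p (y + 1)) ((lam * p (y + 1) - f y) / kap).
    have -> : f y = f (y + 1) by exact/esym/(pf y 1).
    exact: is_derive_translate.
  apply: is_derive_eq; rewrite /GRing.scale/=.
  have -> : m = lam / kap by [].
  by field; rewrite gt_eqF.
have d0 y : is_derive y 1 (cst (0 : R)) 0 by exact: is_derive_cst.
have := eq_is_derive 0 x dw d0; rewrite subrr /w mulr0 expR0 mul1r add0r.
have -> : p 1 - p 0 = 0.
  rewrite /p mulr1 mulr0 expR0 mul1r.
  have -> : expR m * (K - P 1) - (K - P 0) =
    K * (expR m - 1) - (expR m * P 1 - P 0) by ring.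
  by rewrite /K divfK// subrr.
rewrite subr0 => /eqP; rewrite mulf_eq0 gt_eqF ?expR_gt0//= subr_eq0.
by move/eqP.
Qed.

(** At a maximum of p the derivative vanishes, hence lam p = f there. *)
Lemma linear_periodic_le (kap lam : R) f p (B : R) : 0 < kap ->
  periodic p -> (forall x, is_derive x 1 p ((lam * p x - f x) / kap)) ->
  0 < lam ->
  (forall x, f x <= B) -> forall x, lam * p x <= B.
Proof.
move=> kap0 pp dp lam0 fB x.
have [|c pc] := periodic_argmax _ pp; first by move=> y; exact: is_derive1_cont (dp y).
have /eqP := is_derive_max (dp c) pc.
rewrite mulf_eq0 invr_eq0 (gt_eqF kap0) orbF subr_eq0 => /eqP e.
by rewrite (le_trans _ (fB c))// -e ler_wpM2l// ltW.
Qed.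

Lemma linear_periodic_ge (kap lam : R) f p (B : R) : 0 < kap ->
  periodic p -> (forall x, is_derive x 1 p ((lam * p x - f x) / kap)) ->
  0 < lam ->
  (forall x, B <= f x) -> forall x, B <= lam * p x.
Proof.
move=> kap0 pp dp lam0 fB x; rewrite -[leRHS]opprK lerNr -mulrN.
apply: (@linear_periodic_le kap lam (fun x => - f x) (fun x => - p x)) => //.
- by move=> y k; rewrite pp.
- by move=> y; have := dp y => ?; apply: is_derive_eq; ring.
- by move=> y; rewrite lerN2.
Qed.

End PeriodicLinear.

Record forcing (R : realType) (g : R -> R) (m1 m2 L : R) : Prop := Forcing {
  forcing_m1_gt0 : 0 < m1;
  forcing_bnd : forall y, m1 <= g y <= m2;
  forcing_lip : forall y z, `|g y - g z| <= L * `|y - z|;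
  forcing_per : periodic g }.

Section Forcing.
Context {R : realType} (g : R -> R) (m1 m2 L : R).
Hypothesis gF : forcing g m1 m2 L.

Lemma forcing_gt0 y : 0 < g y.
Proof.
have /andP[+ _] := forcing_bnd gF y; exact/lt_le_trans/(forcing_m1_gt0 gF).
Qed.

Lemma forcing_le : m1 <= m2.
Proof. by have /andP[] := forcing_bnd gF 0; exact: le_trans. Qed.

Lemma forcing_m2_gt0 : 0 < m2.
Proof. exact: lt_le_trans (forcing_m1_gt0 gF) forcing_le. Qed.

Lemma forcing_cont : continuous g.
Proof. exact: lipschitz_cont (forcing_lip gF). Qed.

Lemma forcing_L_ge0 : 0 <= L.
Proof.
by have := forcing_lip gF 1 0; rewrite subr0 normr1 mulr1; exact: le_trans.
Qed.

End Forcing.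

Section FixedPoint.
Context {R : realType}.
Implicit Types (p q : R -> R) (x y : R).

Lemma geometric_squeeze (th D a b : R) : 0 <= th < 1 ->
  (forall k, a <= b + th ^+ k * D) -> a <= b.
Proof.
move=> /andP[th0 th1] H; apply/ler_addgt0Pr => e e0.
have D1 : 0 < `|D| + 1 by rewrite ltr_wpDl.
have /cvgrPdist_lt /(_ _ (divr_gt0 e0 D1))[k _ Hk] : th ^+ k @[k --> \oo] --> 0.
  by apply: cvg_expr; rewrite ger0_norm.
have := Hk k (leqnn k); rewrite sub0r normrN ger0_norm ?exprn_ge0// => thk.
rewrite (le_trans (H k))// lerD2l.
rewrite ltr_pdivlMr// in thk; rewrite (le_trans _ (ltW thk))//.
by rewrite ler_wpM2l ?exprn_ge0// (le_trans (ler_norm _))// lerDl.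
Qed.

Context (g : R -> R) (m1 m2 L : R).
Hypothesis gF : forcing g m1 m2 L.

Let m10 := forcing_m1_gt0 gF.
Let m20 := forcing_m2_gt0 gF.
Let m12 := forcing_le gF.
Let g_bnd := forcing_bnd gF.
Let g_cont := forcing_cont gF.
Let g_per := forcing_per gF.

(** The equation reads kap q' = lam q - N q with N q = lam q + g / q - c. For
    lam = m2 / a ^ 2, with [a, b] the range allowed for q, the nonlinearity maps
    [a, b] into [lam a, lam b] and has there a Lipschitz constant th lam with
    th < 1, so that solving the linear equation with right-hand side N q is a
    contraction in the sup norm. The iterates stay in a class of functions with
    a common Lipschitz constant, which passes to the limit. *)
Lemma cell_ode (kap c : R) : 0 < kap -> 0 < c ->
  exists q, [/\ periodic q, forall x, m1 / c <= q x <= m2 / c &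
    forall x, is_derive x 1 q ((c - g x / q x) / kap)].
Proof.
move=> kap0 c0.
pose a := m1 / c; pose b := m2 / c; pose lam := m2 / a ^+ 2.
have a0 : 0 < a by rewrite divr_gt0.
have b0 : 0 < b by rewrite divr_gt0.
have lam0 : 0 < lam by rewrite divr_gt0// exprn_gt0.
have m1a : m1 = c * a by rewrite /a; field; rewrite gt_eqF.
have m2b : m2 = c * b by rewrite /b; field; rewrite gt_eqF.
have m2lam : m2 = lam * a ^+ 2 by rewrite /lam divfK// expf_neq0// gt_eqF.
pose th := (lam - m1 / b ^+ 2) / lam.
have ab : a <= b.
  by rewrite ler_pM2r ?invr_gt0.
have th01 : 0 <= th < 1.
  rewrite /th ltr_pdivrMr// mul1r ltrBlDr ltrDl divr_gt0 ?exprn_gt0// andbT.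
  rewrite divr_ge0 ?(ltW lam0)// subr_ge0 /lam.
  rewrite ler_pM ?(ltW m10)// ?invr_ge0 ?exprn_ge0 ?(ltW b0)//.
  by rewrite lef_pV2 ?posrE ?exprn_gt0// lerXn2r ?nnegrE ?(ltW a0) ?(ltW b0).
have c_lam : c <= lam * a.
  rewrite -(ler_pM2r a0) -mulrA -expr2 -m2lam m2b ler_pM2l//.
pose N (G s : R) := lam * s + G / s - c.
have N_bnd G s : m1 <= G <= m2 -> a <= s <= b -> lam * a <= N G s <= lam * b.
  move=> /andP[G1 G2] /andP[s1 s2]; have s0 : 0 < s := lt_le_trans a0 s1.
  have cs : c <= lam * s by rewrite (le_trans c_lam)// ler_pM2l.
  have NE : N G s = (lam * s ^+ 2 + G - c * s) / s.
    by rewrite /N; field; rewrite gt_eqF.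
  rewrite NE ler_pdivlMr// ler_pdivrMr//.
  by rewrite m1a in G1; rewrite m2b in G2; apply/andP; split; nra.
have N_ctr G s t : m1 <= G <= m2 -> a <= s <= b -> a <= t <= b ->
    `|N G s - N G t| <= th * lam * `|s - t|.
  move=> /andP[G1 G2] /andP[s1 s2] /andP[t1 t2].
  have s0 : 0 < s := lt_le_trans a0 s1; have t0 : 0 < t := lt_le_trans a0 t1.
  have -> : N G s - N G t = (lam - G / (s * t)) * (s - t).
    by rewrite /N; field; rewrite !gt_eqF.
  rewrite normrM ler_wpM2r// /th divfK ?gt_eqF// ger0_norm ?lerB//.
    rewrite ler_pM ?(ltW m10)// ?invr_ge0 ?exprn_ge0 ?(ltW b0)//.
    have st : s * t <= b ^+ 2 by rewrite expr2 ler_pM// ltW.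
    by rewrite lef_pV2 ?posrE ?(exprn_gt0 _ b0) ?mulr_gt0.
  rewrite subr_ge0 ler_pdivrMr ?mulr_gt0// (le_trans G2)// m2lam ler_pM2l//.
  by rewrite expr2 ler_pM// ltW.
pose Lc := lam * (b - a) / kap.
pose X q := [/\ periodic q, forall x, a <= q x <= b &
  forall x y, `|q x - q y| <= Lc * `|x - y|].
pose ode q p := forall x, is_derive x 1 p ((lam * p x - N (g x) (q x)) / kap).
have [S SP] : exists S : (R -> R) -> (R -> R), forall q, X q -> X (S q) /\ ode q (S q).
  suff /boolp.choice[S SP] : forall q, exists p, X q -> X p /\ ode q p by exists S.
  move=> q.
  have [Xq|nXq] := pselect (X q); last by exists q.
  have [pq qb qL] := Xq.
  have cq := lipschitz_cont qL.
  have cN : continuous (fun x => N (g x) (q x)).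
    move=> x; have qx0 : q x != 0.
      by rewrite gt_eqF// (lt_le_trans a0)//; have /andP[] := qb x.
    apply: cvgB; last exact: cvg_cst.
    apply: cvgD; first by apply: cvgMr; exact: cq.
    by apply: cvgM; [exact: g_cont|apply: cvgV => //; exact: cq].
  have [|p pp dp] := linear_periodic_solution kap0 lam0 cN.
    by move=> x k; rewrite pq g_per.
  have pb x : a <= p x <= b.
    rewrite -(ler_pM2l lam0) -[X in _ && X](ler_pM2l lam0); apply/andP; split.
      apply: (linear_periodic_ge kap0 pp dp lam0) => y.
      by have /andP[] := N_bnd _ _ (g_bnd y) (qb y).
    apply: (linear_periodic_le kap0 pp dp lam0) => y.
    by have /andP[] := N_bnd _ _ (g_bnd y) (qb y).
  exists p => _; split => //; split => //.
  apply: (lipschitz_is_derive dp) => x.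
  rewrite normrM [`|kap^-1|]gtr0_norm ?invr_gt0// ler_pM2r ?invr_gt0//.
  have /andP[n1 n2] := N_bnd _ _ (g_bnd x) (qb x).
  have /andP[p1 p2] := pb x.
  rewrite -(ler_pM2l lam0) in p1; rewrite -(ler_pM2l lam0) in p2.
  by rewrite ler_norml; lra.
have S_ctr q r (D : R) : X q -> X r -> (forall x, `|q x - r x| <= D) ->
    forall x, `|S q x - S r x| <= th * D.
  move=> Xq Xr qr x; have [Xp op] := SP q Xq; have [Xs os] := SP r Xr.
  have [[_ qb _] [_ rb _]] := (Xq, Xr).
  pose f y := N (g y) (q y) - N (g y) (r y).
  have fD y : `|f y| <= lam * (th * D).
    rewrite (le_trans (N_ctr _ _ _ (g_bnd y) (qb y) (rb y)))//.
    rewrite mulrA [lam * th]mulrC ler_wpM2l//.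
    by have /andP[th0 _] := th01; rewrite mulr_ge0// ltW.
  pose w y := S q y - S r y.
  have dw y : is_derive y 1 w ((lam * w y - f y) / kap).
    have := op y => ?; have := os y => ?; apply: is_derive_eq.
    by rewrite /w /f; ring.
  have pw : periodic w.
    by move=> y k; rewrite /w; have [-> _ _] := Xp; have [-> _ _] := Xs.
  rewrite -/(w x) ler_norml -(ler_pM2l lam0) -[X in _ && X](ler_pM2l lam0).
  rewrite mulrN; apply/andP; split.
    apply: (linear_periodic_ge kap0 pw dw lam0) => y.
    by have := fD y; rewrite ler_norml => /andP[].
  apply: (linear_periodic_le kap0 pw dw lam0) => y.
  by have := fD y; rewrite ler_norml => /andP[].
pose Q k := iter k S (cst a).
have XQ k : X (Q k).
  elim: k => [|k /SP[]//]; split => // [x|x y]; first by rewrite /= lexx.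
  rewrite subrr normr0 mulr_ge0// /Lc divr_ge0 ?(ltW kap0)//.
  by rewrite mulr_ge0 ?subr_ge0 ?(ltW lam0).
pose D := b - a.
(* Q (k + j) and Q k are the images of Q j and Q 0 under k contractions. *)
have Qd j k x : `|Q (k + j)%N x - Q k x| <= th ^+ k * D.
  elim: k x => [|k IH] x.
    rewrite add0n expr0 mul1r /D; have [_ Qb _] := XQ j.
    have /andP[h1 h2] := Qb x.
    by rewrite /Q ger0_norm ?subr_ge0//= lerB.
  by rewrite addSn exprS -mulrA; exact: S_ctr.
have Qle i j x : Q i x - th ^+ i * D <= Q j x + th ^+ j * D.
  have := Qd j i x; have := Qd i j x; rewrite addnC !ler_norml.
  by move=> /andP[? ?] /andP[? ?]; lra.
(* The intervals of radius th ^ k D around the iterates meet pairwise; the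
   supremum of their left ends belongs to all of them. *)
pose q x := sup [set Q i x - th ^+ i * D | i in setT].
have qQ k x : `|q x - Q k x| <= th ^+ k * D.
  have hs : has_sup [set Q i x - th ^+ i * D | i in setT].
    split; first by exists (Q 0%N x - th ^+ 0 * D); exists 0%N.
    by exists (Q 0%N x + th ^+ 0 * D) => _ [i _ <-]; exact: Qle.
  rewrite ler_distl; apply/andP; split.
    by apply: sup_upper_bound => //; exists k.
  apply: sup_le_ub; first by case: hs.
  by move=> _ [i _ <-]; exact: Qle.
have qQ' k x : Q k x - th ^+ k * D <= q x <= Q k x + th ^+ k * D.
  by rewrite -ler_distl.
have Xq : X q.
  split.
  - by move=> x k; rewrite /q; congr sup; apply: eq_imagel => i _; have [->] := XQ i.
  - move=> x; apply/andP; split; apply: (@geometric_squeeze th D _ _ th01) => k.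
      have := qQ' k x; have [_ /(_ x) + _] := XQ k; move=> /andP[? ?] /andP[? ?]; lra.
    have := qQ' k x; have [_ /(_ x) + _] := XQ k; move=> /andP[? ?] /andP[? ?]; lra.
  - move=> x y; apply: (@geometric_squeeze th (2 * D) _ _ th01) => k.
    have := qQ' k x; have := qQ' k y; have [_ _ /(_ x y)] := XQ k.
    rewrite !ler_norml; move: (Lc * _) => z /andP[? ?] /andP[? ?] /andP[? ?].
    by lra.
have [Xp op] := SP q Xq.
have SqE x : S q x = q x.
  apply/eqP; rewrite -subr_eq0 -normr_le0.
  apply: (@geometric_squeeze th (2 * D) _ _ th01) => k; rewrite add0r.
  have h1 : `|S q x - S (Q k) x| <= th * (th ^+ k * D) := S_ctr q (Q k) _ Xq (XQ k) (qQ k) x.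
  have h2 := qQ' k.+1 x; rewrite exprS -[Q k.+1 x]/(S (Q k) x) in h2.
  have D0 : 0 <= th ^+ k * D.
    by rewrite mulr_ge0 ?exprn_ge0 ?subr_ge0//; case/andP: th01.
  have : th * (th ^+ k * D) <= th ^+ k * D.
    by rewrite ler_piMl//; case/andP: th01 => _ /ltW.
  have -> : th ^+ k * (2 * D) = 2 * (th ^+ k * D) by ring.
  move: h1 h2; rewrite -mulrA !ler_norml; set A := th * _; set B := th ^+ k * D.
  by move=> /andP[? ?] /andP[? ?] ?; lra.
have Sq : S q = q by apply/funext.
rewrite /ode Sq in op; exists q; split=> [||x]; [by case: Xq|by case: Xq|].
by apply: (is_derive_eq (op x)); rewrite /N; ring.
Qed.

End FixedPoint.

(** * Correctors and their speed *)

(** The pulsating waves W (z + c t) of w_t = kap w_zz + g (w), with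
    W (z + 1) = W z + 1, in phase-plane form: q y is the slope of W at height y,
    and Gam is the inverse of W. *)
Record corrector (R : realType) (g : R -> R) (kap c : R) (q Gam : R -> R) : Prop :=
  Corrector {
  corrector_kap_gt0 : 0 < kap;
  corrector_per : periodic q;
  corrector_gt0 : forall y : R, 0 < q y;
  corrector_eq : forall y : R, is_derive y 1 q ((c - g y / q y) / kap);
  corrector_prim : forall y : R, is_derive y 1 Gam (q y)^-1;
  corrector_0 : Gam 0 = 0;
  corrector_1 : Gam 1 = 1 }.

Lemma inv_lip (R : realType) (a s t : R) : 0 < a -> a <= s -> a <= t ->
  `|s^-1 - t^-1| <= `|s - t| / a ^+ 2.
Proof.
move=> a0 s1 t1; have s0 := lt_le_trans a0 s1; have t0 := lt_le_trans a0 t1.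
have -> : s^-1 - t^-1 = (t - s) / (s * t) by field; rewrite !gt_eqF.
rewrite normrM distrC ler_wpM2l// gtr0_norm ?invr_gt0 ?mulr_gt0//.
rewrite lef_pV2 ?posrE ?mulr_gt0 ?exprn_gt0//.
by rewrite expr2 ler_pM// ltW.
Qed.

Section Corrector.
Context {R : realType}.
Implicit Types (p q Gam : R -> R) (x y : R).
Context (g : R -> R) (m1 m2 L : R).
Hypothesis gF : forcing g m1 m2 L.

Let m10 := forcing_m1_gt0 gF.
Let m20 := forcing_m2_gt0 gF.
Let m12 := forcing_le gF.
Let g_bnd := forcing_bnd gF.
Let g_gt0 := forcing_gt0 gF.

(** At a maximum of q - p the derivatives of q and p agree, which leaves an
    algebraic relation between the values of q and p there. *)
Lemma cell_ode_lip (kap c d : R) q p : 0 < kap -> m1 <= c -> m1 <= d ->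
  periodic q -> periodic p ->
  (forall y, 0 < q y <= m2 / m1) -> (forall y, 0 < p y <= m2 / m1) ->
  (forall x, is_derive x 1 q ((c - g x / q x) / kap)) ->
  (forall x, is_derive x 1 p ((d - g x / p x) / kap)) ->
  forall x, q x - p x <= (m2 / m1) ^+ 2 / m1 * `|c - d|.
Proof.
move=> kap0 c1 d1 pq pp qb pb dq dp x.
pose w y := q y - p y.
have dw y : is_derive y 1 w (((c - g y / q y) - (d - g y / p y)) / kap).
  by have := dq y => ?; have := dp y => ?; apply: is_derive_eq; ring.
have [||z wz] := @periodic_argmax _ w.
- by move=> y; exact: is_derive1_cont (dw y).
- by move=> y k; rewrite /w pq pp.
have /eqP := is_derive_max (dw z) wz.
rewrite mulf_eq0 invr_eq0 (gt_eqF kap0) orbF => /eqP e.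
have /andP[q0 q1] := qb z; have /andP[p0 p1] := pb z.
have wE : w z = (d - c) * (q z * p z) / g z.
  have : g z * (q z - p z) = (d - c) * (q z * p z).
    have qz : q z != 0 by rewrite gt_eqF.
    have pz : p z != 0 by rewrite gt_eqF.
    have -> : d - c = - g z / q z + g z / p z.
      by apply/eqP; rewrite -subr_eq0 -[X in _ == X]oppr0 -e; apply/eqP; ring.
    by field; rewrite qz pz.
  by move=> <-; rewrite /w; field; rewrite gt_eqF.
rewrite (le_trans (wz x))// wE -mulrA mulrC.
have A : d - c <= `|c - d| by rewrite distrC ler_norm.
rewrite (le_trans (ler_wpM2l _ A))//.
  by rewrite divr_ge0 ?mulr_ge0 ?(ltW q0) ?(ltW p0) ?(ltW (g_gt0 z)).
rewrite ler_wpM2r// ler_pM ?mulr_ge0 ?invr_ge0 ?(ltW q0) ?(ltW p0) ?(ltW (g_gt0 z))//.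
  by rewrite expr2 ler_pM// ltW.
by rewrite lef_pV2 ?posrE//; have /andP[] := g_bnd z.
Qed.

(** The mean of 1 / q is at most 1 for c = m1, at least 1 for c = m2, and
    depends continuously on c, so that the intermediate value theorem provides
    the normalisation. Clamping c to [m1, m2] makes this dependence Lipschitz on
    the whole line. *)
Lemma corrector_exists (kap : R) : 0 < kap ->
  exists c q Gam, corrector g kap c q Gam.
Proof.
move=> kap0; pose cl (c : R) := Num.max m1 (Num.min c m2).
have clb c : m1 <= cl c <= m2.
  by rewrite le_max lexx /= ge_max m12 ge_min lexx orbT.
have cl0 c : 0 < cl c by have /andP[+ _] := clb c; exact: lt_le_trans.
have clid c : m1 <= c <= m2 -> cl c = c.
  by move=> /andP[c1 c2]; rewrite /cl min_l// max_r.
have cl_lip c d : `|cl c - cl d| <= `|c - d|.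
  have := ler_norm (c - d); have := ler_norm (d - c); rewrite (distrC d c).
  rewrite /cl ler_norml; have := m12.
  by case: (leP c m2) => ?; case: (leP d m2) => ?; case: (leP m1 m2) => ?;
    case: (leP m1 c) => ?; case: (leP m1 d) => ?; lra.
have /boolp.choice[q qP] := fun c => cell_ode gF kap0 (cl0 c).
have qb c y : m1 / m2 <= q c y <= m2 / m1.
  have [_ /(_ y)/andP[h1 h2] _] := qP c; have /andP[c1 c2] := clb c.
  rewrite (le_trans _ h1) ?(le_trans h2)//.
    by rewrite ler_pM2l// lef_pV2// posrE.
  by rewrite ler_pM2l// lef_pV2// posrE.
have q0 c y : 0 < q c y.
  by have /andP[+ _] := qb c y; apply: lt_le_trans; rewrite divr_gt0.
have cq c : continuous (q c).
  by move=> y; have [_ _ d] := qP c; exact: is_derive1_cont (d y).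
have /boolp.choice[G GP] : forall c, exists G, forall x, is_derive x 1 G (q c x)^-1.
  move=> c; apply: antiderivative => y; apply: cvgV; last exact: cq.
  by rewrite gt_eqF.
pose T c := G c 1 - G c 0.
pose K := (m2 / m1) ^+ 2 / m1 / (m1 / m2) ^+ 2.
have dK (K' : R) x : is_derive x 1 ( *%R K') K'.
  by apply: is_derive_eq; rewrite [_%:A]mulr1.
have T_le c d : T c - T d <= K * `|c - d|.
  have dGB y : is_derive y 1 (G c - G d) ((q c y)^-1 - (q d y)^-1).
    by have := GP c y => ?; have := GP d y => ?; exact: is_deriveB.
  have := @le_is_derive _ _ _ _ _ 0 1 dGB (dK (K * `|c - d|)) _ ler01.
  rewrite mulr1 mulr0 subr0 -![(_ - _ : _ -> _) _]/(_ - _) => le1.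
  rewrite (le_trans _ (le1 _))//; first by rewrite /T; lra.
  move=> y; rewrite (le_trans (ler_norm _))//.
  have m120 : 0 < m1 / m2 by rewrite divr_gt0.
  have /andP[c1 c2] := qb c y; have /andP[d1 d2] := qb d y.
  rewrite (le_trans (inv_lip m120 c1 d1))// /K mulrAC ler_wpM2r//.
    by rewrite invr_ge0 exprn_ge0// ltW.
  have q0m e z : 0 < q e z <= m2 / m1 by rewrite q0; have /andP[] := qb e z.
  have [pc _ Dc] := qP c; have [pd _ Dd] := qP d.
  have /andP[clc _] := clb c; have /andP[cld _] := clb d.
  have key1 := cell_ode_lip kap0 clc cld pc pd (q0m c) (q0m d) Dc Dd y.
  have key2 := cell_ode_lip kap0 cld clc pd pc (q0m d) (q0m c) Dd Dc y.
  have Kp : 0 <= (m2 / m1) ^+ 2 / m1 by rewrite !mulr_ge0// ?invr_ge0 ltW.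
  have := ler_wpM2l Kp (cl_lip c d).
  rewrite distrC in key2; rewrite ler_norml; lra.
have cT : continuous T.
  apply: (@lipschitz_cont _ T K) => c d; rewrite ler_norml.
  by have := T_le c d; have := T_le d c; rewrite distrC; lra.
have dq1 x : is_derive x 1 (fun y : R => y) 1 by exact: is_derive_id.
have T1 : T m1 <= 1.
  have := @le_is_derive _ _ _ _ _ 0 1 (GP m1) dq1 _ ler01.
  rewrite subr0; apply => y; have [_ /(_ y)/andP[h _] _] := qP m1.
  by rewrite clid ?lexx// divff ?gt_eqF// in h; rewrite invf_le1.
have T2 : 1 <= T m2.
  have := @le_is_derive _ _ _ _ _ 0 1 dq1 (GP m2) _ ler01.
  rewrite subr0; apply => y; have [_ /(_ y)/andP[_ h] _] := qP m2.
  by rewrite clid ?lexx ?andbT// divff ?gt_eqF// in h; rewrite invf_ge1.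
have [||c] := @IVT R T m1 m2 1 m12.
- exact: continuous_subspaceT.
- by rewrite ge_min le_max T1 T2 orbT.
rewrite in_itv/= => c12 Tc1.
exists c, (q c), (fun x => G c x - G c 0); split => //.
- by have [] := qP c.
- by have [_ _] := qP c; rewrite clid.
- by move=> y; have := GP c y => ?; apply: is_derive_eq; rewrite subr0.
- by rewrite subrr.
Qed.

End Corrector.

Definition arith_mean (R : realType) (g : R -> R) : R :=
  (\int[lebesgue_measure]_(s in `[0%R, 1%R]) g s)%R.

Definition harm_mean (R : realType) (g : R -> R) : R :=
  (\int[lebesgue_measure]_(s in `[0%R, 1%R]) (g s)^-1)%R^-1.

Section Means.
Context {R : realType} (g : R -> R) (m1 m2 L : R).
Hypothesis gF : forcing g m1 m2 L.

Lemma inv_forcing_cont : continuous (fun s => (g s)^-1).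
Proof.
move=> s; apply: cvgV; last exact: (forcing_cont gF).
by rewrite gt_eqF// (forcing_gt0 gF).
Qed.

Lemma harm_mean_gt0 : 0 < harm_mean g.
Proof.
have [H dH] := antiderivative inv_forcing_cont.
rewrite /harm_mean (Rintegral_antiderivative inv_forcing_cont dH) invr_gt0.
have dlin (x : R) : is_derive x 1 ( *%R m2^-1) m2^-1.
  by apply: is_derive_eq; rewrite [_%:A]mulr1.
have := @le_is_derive _ _ _ _ _ 0 1 dlin dH _ ler01.
rewrite mulr1 mulr0 subr0 => H0.
rewrite (lt_le_trans _ (H0 _)) ?invr_gt0 ?(forcing_m2_gt0 gF)// => x.
rewrite lef_pV2 ?posrE ?(forcing_gt0 gF) ?(forcing_m2_gt0 gF)//.
by have /andP[] := forcing_bnd gF x.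
Qed.

End Means.

Section CorrectorBounds.
Context {R : realType}.
Implicit Types (p q Gam : R -> R) (x y z t : R).
Context (g : R -> R) (m1 m2 L : R).
Hypothesis gF : forcing g m1 m2 L.
Context (kap c : R) (q Gam : R -> R).
Hypothesis cor : corrector g kap c q Gam.

Let m10 := forcing_m1_gt0 gF.
Let m20 := forcing_m2_gt0 gF.
Let m12 := forcing_le gF.
Let g_bnd := forcing_bnd gF.
Let g_lip := forcing_lip gF.
Let g_gt0 := forcing_gt0 gF.
Let g_cont := forcing_cont gF.
Let gV_cont := inv_forcing_cont gF.
Let kap0 := corrector_kap_gt0 cor.

Let dq y : R := (c - g y / q y) / kap.

Let q0 := corrector_gt0 cor.
Let q' y : is_derive y 1 q (dq y) := corrector_eq cor y.
Let Gam' y : is_derive y 1 Gam (q y)^-1 := corrector_prim cor y.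
Let qN0 y : q y != 0. Proof. by rewrite gt_eqF ?q0. Qed.
Let gN0 y : g y != 0. Proof. by rewrite gt_eqF. Qed.
Let kapN0 : kap != 0. Proof. by rewrite gt_eqF. Qed.

Let q_cont : continuous q.
Proof. by move=> y; exact: is_derive1_cont (q' y). Qed.

Let critical z : dq z = 0 -> c * q z = g z.
Proof.
move/eqP; rewrite mulf_eq0 invr_eq0 (negPf kapN0) orbF subr_eq0 => /eqP ->.
by rewrite divfK.
Qed.

(** At an extremum of q the equation reduces to c q = g. *)
Lemma corrector_bnd y : m1 <= c * q y <= m2.
Proof.
have [z qz] := periodic_argmax q_cont (corrector_per cor).
have [||t qt] := @periodic_argmax _ (fun y => - q y).
- by move=> x; apply: cvgN; exact: q_cont.
- by move=> x k; rewrite (corrector_per cor).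
have cz := critical (is_derive_max (q' z) qz).
have ct : c * q t = g t.
  by apply/critical/(is_derive_min (q' t)) => x; rewrite -lerN2.
have c0 : 0 < c by rewrite -(pmulr_lgt0 _ (q0 z)) cz.
have /andP[gz1 gz2] := g_bnd z; have /andP[gt1 gt2] := g_bnd t.
apply/andP; split.
  by rewrite (le_trans gt1)// -ct ler_pM2l// -lerN2.
by rewrite (le_trans _ gz2)// -cz ler_pM2l.
Qed.

(** Since 1 / q has mean 1, the bounds on c q are also bounds on c. *)
Lemma corrector_speed : m1 <= c <= m2.
Proof.
have dlin (K x : R) : is_derive x 1 ( *%R K) K.
  by apply: is_derive_eq; rewrite [_%:A]mulr1.
have c0 : 0 < c.
  rewrite -(pmulr_lgt0 _ (q0 0)); apply: lt_le_trans m10 _.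
  by have /andP[] := corrector_bnd 0.
have := @le_is_derive _ _ _ _ _ 0 1 Gam' (dlin (c / m1)) _ ler01.
have := @le_is_derive _ _ _ _ _ 0 1 (dlin (c / m2)) Gam' _ ler01.
rewrite (corrector_0 cor) (corrector_1 cor) !mulr1 !mulr0 !subr0 => h2 h1.
apply/andP; split.
  rewrite -[m1]mul1r -ler_pdivlMr//; apply: h1 => x.
  rewrite ler_pdivlMr// mulrC ler_pdivrMr ?q0//.
  by have /andP[] := corrector_bnd x.
rewrite -[m2]mul1r -ler_pdivrMr//; apply: h2 => x.
rewrite ler_pdivrMr// mulrC ler_pdivlMr ?q0//.
by have /andP[] := corrector_bnd x.
Qed.

Let c12 := corrector_speed.

Let c0 : 0 < c.
Proof. by have /andP[+ _] := c12; exact: lt_le_trans. Qed.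

Let cN0 : c != 0. Proof. by rewrite gt_eqF. Qed.

Lemma corrector_primD1 y : Gam (y + 1) = Gam y + 1.
Proof.
have d1 x : is_derive x 1 (fun z => Gam (z + 1)) (q x)^-1.
  have -> : q x = q (x + 1) by exact/esym/(corrector_per cor x 1).
  exact: is_derive_translate.
have := eq_is_derive 0 y d1 Gam'.
by rewrite add0r (corrector_0 cor) (corrector_1 cor); lra.
Qed.

(** The difference Gam - id is periodic, and Gam maps [0, 1] to itself. *)
Lemma corrector_prim_near y : `|Gam y - y| <= 1.
Proof.
have cD : continuous (fun y => Gam y - y).
  by move=> x; apply: cvgB; [exact: is_derive1_cont (Gam' x)|exact: cvg_id].
have pD : periodic (fun y => Gam y - y).
  by apply: periodic_of_step => x; rewrite corrector_primD1; ring.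
have inc a b : a <= b -> Gam a <= Gam b.
  have d0 x : is_derive x 1 (cst (0 : R)) 0 by exact: is_derive_cst.
  move=> ab; have := le_is_derive d0 Gam' _ ab.
  by rewrite subrr subr_ge0; apply => x; rewrite invr_ge0 ltW.
rewrite -(pD y (- Num.floor y)) mulrNz -/(_ - _).
have /andP[] := floor_itv y; rewrite intrD; set z := y - _ => z0 z1.
have {}z0 : 0 <= z by rewrite /z; lra.
have {}z1 : z <= 1 by rewrite /z; lra.
have := inc _ _ z0; have := inc _ _ z1.
by rewrite (corrector_0 cor) (corrector_1 cor) ler_norml; lra.
Qed.

(** This bound on the derivative of q is the strong one for large kap; the next
    one does not deteriorate as kap tends to 0. *)
Lemma corrector_deriv_le1 y : kap * `|dq y| <= m2 ^+ 2 / m1.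
Proof.
rewrite /dq normrM [`|kap^-1|]gtr0_norm ?invr_gt0// mulrC divfK//.
have /andP[h1 h2] := corrector_bnd y.
have /andP[g1 g2] := g_bnd y; have /andP[c1 c2] := c12.
have c_le : c <= m2 ^+ 2 / m1.
  by rewrite (le_trans c2)// ler_pdivlMr// expr2 ler_pM2l.
have gq : 0 <= g y / q y <= m2 ^+ 2 / m1.
  rewrite divr_ge0 ?(ltW (g_gt0 y)) ?(ltW (q0 y))//= ler_pdivrMr ?q0//.
  rewrite mulrAC ler_pdivlMr// expr2 -mulrA ler_pM// ?(ltW m10) ?(ltW (g_gt0 y))//.
  by rewrite (le_trans h1)// ler_wpM2r// ltW.
by move: gq => /andP[? ?]; have := c0; rewrite ler_norml; lra.
Qed.

(** Comparison of q with its translates: where q (y + s) - q y is largest, g / q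
    takes the same value at y and at y + s, so that the increment of q is
    controlled by the increment of g. *)
Lemma corrector_deriv_le2 y : `|dq y| <= L * (m2 / m1) / m1.
Proof.
set B := L * _ / _.
have qB s x : q (x + s) - q x <= B * `|s|.
  pose w z := q (z + s) - q z.
  have dw z : is_derive z 1 w (dq (z + s) - dq z).
    have := q' z => ?.
    have ? : is_derive z 1 (fun t => q (t + s)) (dq (z + s)).
      by exact: is_derive_translate.
    by apply: is_derive_eq.
  have [||z wz] := @periodic_argmax _ w.
  - by move=> z; exact: is_derive1_cont (dw z).
  - by move=> z k; rewrite /w addrAC !(corrector_per cor).
  have e : g (z + s) / q (z + s) = g z / q z.
    have /eqP := is_derive_max (dw z) wz.
    rewrite /dq -mulrBl mulf_eq0 invr_eq0 (negPf kapN0) orbF => /eqP.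
    by set X := g (z + s) / _; set Y := g z / _; lra.
  have wE : w z = (g (z + s) - g z) * (q z / g z).
    have qE : q (z + s) = g (z + s) * (q z / g z).
      by rewrite -[q z / _]invf_div -e; field; rewrite gN0 qN0.
    by rewrite /w qE; field; rewrite gN0.
  rewrite (le_trans (wz x))// wE /B.
  have A : g (z + s) - g z <= L * `|s|.
    rewrite (le_trans (ler_norm _))// (le_trans (g_lip _ _))//.
    by rewrite [z + s]addrC addrK.
  rewrite (le_trans (ler_wpM2r _ A)) ?divr_ge0 ?(ltW (g_gt0 z)) ?(ltW (q0 z))//.
  have Ls : 0 <= L * `|s|.
    have := g_lip (z + s) z; rewrite [z + s]addrC addrK.
    exact: le_trans.
  have -> : L * (m2 / m1) / m1 * `|s| = L * `|s| * (m2 / m1 / m1) by ring.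
  rewrite ler_wpM2l// ler_pM ?invr_ge0 ?(ltW (q0 z)) ?(ltW (g_gt0 z))//.
    have /andP[_ h2] := corrector_bnd z; have /andP[c1 _] := c12.
    by rewrite ler_pdivlMr// mulrC (le_trans _ h2)// ler_wpM2r// ltW.
  by rewrite lef_pV2 ?posrE//; have /andP[] := g_bnd z.
have one (s : R) : s = 1 \/ s = -1 -> s * dq y <= B.
  move=> s1; rewrite leNgt; apply/negP; rewrite -subr_gt0 => d0.
  have ? : is_derive (0 : R) 1 (fun t => q (y + s * t)) (s * dq y).
    have -> : (fun t => q (y + s * t)) = q \o (fun t => y + s * t) by [].
    rewrite mulrC; apply: is_derive1_comp; first by rewrite mulr0 addr0.
    by apply: is_derive_eq; rewrite /GRing.scale/=; ring.
  have D : is_derive (0 : R) 1 (fun t => q (y + s * t) - B * t) (s * dq y - B).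
    by apply: is_derive_eq; rewrite /GRing.scale/=; ring.
  have [e e0 H] := is_derive_pos_quotient D d0.
  have := H (e / 2); rewrite gt_eqF ?divr_gt0// => /(_ isT).
  rewrite gtr0_norm ?divr_gt0// ltr_pdivrMr// ltr_pMr// ltr1n => /(_ isT).
  rewrite pmulr_rgt0 ?invr_gt0 ?divr_gt0// !mulr0 add0r addr0 subr0.
  have := qB (s * (e / 2)) y.
  have -> : `|s * (e / 2)| = e / 2.
    have e2 : `|e / 2| = e / 2 by rewrite gtr0_norm// divr_gt0.
    by case: s1 => ->; rewrite ?mul1r ?mulN1r ?normrN e2.
  by lra.
have := one 1 (or_introl erefl); have := one (-1) (or_intror erefl).
by rewrite ler_norml mul1r mulN1r; lra.
Qed.

(** In every period 1 / q takes its mean value 1, and q varies little when kap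
    is large. *)
Lemma corrector_near1 y : `|q y - 1| <= m2 ^+ 2 / m1 / kap.
Proof.
have [|z /andP[z1 z2]] := is_derive_MVT (a := y) (b := y + 1) Gam'.
  by rewrite lerDl.
rewrite corrector_primD1 [Gam y + 1]addrC [y + 1]addrC !addrK mulr1 => e.
have qz : q z = 1 by rewrite -[RHS]invr1 e invrK.
rewrite -qz (le_trans (lipschitz_is_derive (K := m2 ^+ 2 / m1 / kap) q' _ _ _))//.
  by move=> x; rewrite ler_pdivlMr// mulrC corrector_deriv_le1.
rewrite ler_piMr//; last by rewrite ler_norml; lra.
by rewrite !mulr_ge0// ?invr_ge0 ltW.
Qed.

(** Multiplied by q and integrated over a period, the equation says that
    arith_mean g is c times the mean of q. That mean is at least 1 because
    q + 1 / q >= 2, and at most 1 + O(1 / kap) because q is close to 1. *)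
Lemma corrector_arith :
  arith_mean g - m2 * (m2 ^+ 2 / m1) / kap <= c <= arith_mean g.
Proof.
have [G dG] := antiderivative g_cont.
rewrite /arith_mean (Rintegral_antiderivative g_cont dG).
have [Q dQ] := antiderivative q_cont.
pose W y := kap / 2 * q y ^+ 2 + G y - c * Q y.
have dW y : is_derive y 1 W 0.
  have := q' y => ?; have := dG y => ?; have := dQ y => ?.
  apply: is_derive_eq; rewrite /GRing.scale/= /dq; field.
  by rewrite qN0 kapN0.
have d0 x : is_derive x 1 (cst (0 : R)) 0 by exact: is_derive_cst.
have := eq_is_derive 0 1 dW d0; rewrite subrr /W.
have -> : q 1 = q 0 by rewrite -[1]add0r; exact: (corrector_per cor 0 1).
move=> e; have {e} AE : G 1 - G 0 = c * (Q 1 - Q 0) by lra.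
have dq2 (K x : R) : is_derive x 1 ( *%R K) K.
  by apply: is_derive_eq; rewrite [_%:A]mulr1.
have Q1 : 1 <= Q 1 - Q 0.
  have dS y : is_derive y 1 (Q + Gam) (q y + (q y)^-1).
    by have := dQ y => ?; have := Gam' y => ?; exact: is_deriveD.
  have := @le_is_derive _ _ _ _ _ 0 1 (dq2 2) dS _ ler01.
  rewrite -![(Q + Gam) _]/(Q _ + Gam _) (corrector_0 cor) (corrector_1 cor).
  rewrite mulr1 mulr0 => H; suff: 2 - 0 <= Q 1 + 1 - (Q 0 + 0) by lra.
  apply: H => x; rewrite -subr_ge0.
  have -> : q x + (q x)^-1 - 2 = (q x - 1) ^+ 2 / q x by field.
  by rewrite divr_ge0 ?sqr_ge0 ?ltW.
have Q2 : Q 1 - Q 0 <= 1 + m2 ^+ 2 / m1 / kap.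
  have := @le_is_derive _ _ _ _ _ 0 1 dQ (dq2 (1 + m2 ^+ 2 / m1 / kap)) _ ler01.
  rewrite mulr1 mulr0 subr0; apply => x.
  by have := corrector_near1 x; rewrite ler_norml => /andP[? ?]; lra.
have /andP[c1 c2] := c12.
rewrite AE; apply/andP; split; last by rewrite ler_pMr.
have B0 : 0 <= m2 ^+ 2 / m1 / kap by rewrite !mulr_ge0 ?invr_ge0// ltW.
have h1 := ler_wpM2l (ltW c0) Q2; have h2 := ler_wpM2r B0 c2.
have -> : m2 * (m2 ^+ 2 / m1) / kap = m2 * (m2 ^+ 2 / m1 / kap) by ring.
by lra.
Qed.

(** Put r = c - kap q' = g / q. By convexity of the inverse,
    1 / g = 1 / (q r) >= (1 / q) (1 / c + kap q' / c ^ 2), and the right-hand side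
    has mean 1 / c because q' / q is the derivative of a periodic function.
    The bound holds for every kap, so that the plateau of the limit profile is
    sustained at all small slopes. *)
Lemma corrector_harm_le : harm_mean g <= c.
Proof.
have [H dH] := antiderivative gV_cont.
have IE : (harm_mean g)^-1 = H 1 - H 0.
  by rewrite /harm_mean invrK (Rintegral_antiderivative gV_cont dH).
pose W y := c^-1 * Gam y + kap / c ^+ 2 * ln (q y).
have dW y : is_derive y 1 W (c^-1 / q y + kap / c ^+ 2 * (dq y / q y)).
  have := q' y => ?; have := Gam' y => ?.
  have ? : is_derive y 1 (fun y => ln (q y)) ((q y)^-1 * dq y).
    have -> : (fun y => ln (q y)) = (@ln R) \o q by [].
    by apply: is_derive1_comp; exact: is_derive1_ln.
  by apply: is_derive_eq; rewrite /GRing.scale/=; ring.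
have := @le_is_derive _ _ _ _ _ 0 1 dW dH _ ler01.
have q10 : q 1 = q 0 by rewrite -[1]add0r; exact: (corrector_per cor 0 1).
rewrite /W (corrector_0 cor) (corrector_1 cor) q10 => le1.
rewrite -lef_pV2 ?posrE ?(harm_mean_gt0 gF) ?c0// IE.
suff /le1 : forall x, c^-1 / q x + kap / c ^+ 2 * (dq x / q x) <= (g x)^-1 by lra.
move=> x; rewrite -subr_ge0.
have -> : (g x)^-1 - (c^-1 / q x + kap / c ^+ 2 * (dq x / q x)) =
   (c - g x / q x) ^+ 2 / (g x * c ^+ 2).
  by rewrite /dq; field; rewrite gN0 qN0 cN0 kapN0.
by rewrite divr_ge0 ?sqr_ge0// mulr_ge0 ?exprn_ge0 ?(ltW c0) ?(ltW (g_gt0 x)).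
Qed.

(** Here 1 / q = (c - kap q') / g, with q' bounded independently of kap. *)
Lemma corrector_harm_ge : c - kap * (L * (m2 / m1) / m1) <= harm_mean g.
Proof.
set B := L * _ / _; have [H dH] := antiderivative gV_cont.
have h0 := harm_mean_gt0 gF.
have IE : (harm_mean g)^-1 = H 1 - H 0.
  by rewrite /harm_mean invrK (Rintegral_antiderivative gV_cont dH).
suff : (c - kap * B) / harm_mean g <= 1 by rewrite ler_pdivrMr// mul1r.
rewrite IE.
have d1 y : is_derive y 1 (fun y => (c - kap * B) * H y) ((c - kap * B) / g y).
  by have := dH y => ?; apply: is_derive_eq.
have := @le_is_derive _ _ _ _ _ 0 1 d1 Gam' _ ler01.
rewrite (corrector_0 cor) (corrector_1 cor) subr0 mulrBr; apply => x.
rewrite ler_pdivrMr//.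
have -> : (q x)^-1 * g x = c - kap * dq x by rewrite /dq; field; rewrite kapN0 qN0.
by rewrite lerB// ler_pM2l// (le_trans (ler_norm _))// corrector_deriv_le2.
Qed.

End CorrectorBounds.

(** The speed of any corrector lies between the two means. *)
Lemma harm_le_arith (R : realType) (g : R -> R) (m1 m2 L : R) :
  forcing g m1 m2 L -> harm_mean g <= arith_mean g.
Proof.
move=> gF; have [c [q [Gam cor]]] := corrector_exists gF ltr01.
have /andP[_] := corrector_arith gF cor.
exact: le_trans (corrector_harm_le gF cor).
Qed.

(** * The Euclidean norm and minima of coercive functions *)

Section Euclid.
Context {R : realType} {n : nat}.
Implicit Types (x y p : 'rV[R]_n).

Definition dotv x y : R := \sum_(i < n) x 0 i * y 0 i.

Lemma enorm_ge0 x : 0 <= enorm x. Proof. exact: sqrtr_ge0. Qed.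

Lemma sqr_enorm x : enorm x ^+ 2 = \sum_(i < n) x 0 i ^+ 2.
Proof. by rewrite sqr_sqrtr// sumr_ge0// => i _; rewrite sqr_ge0. Qed.

Lemma dotvv x : dotv x x = enorm x ^+ 2.
Proof. by rewrite sqr_enorm; apply: eq_bigr => i _; rewrite expr2. Qed.

Lemma dotvC x y : dotv x y = dotv y x.
Proof. by apply: eq_bigr => i _; rewrite mulrC. Qed.

Lemma dotvDl x y p : dotv (x + y) p = dotv x p + dotv y p.
Proof. by rewrite -big_split; apply: eq_bigr => i _; rewrite mxE mulrDl. Qed.

Lemma dotvZl (k : R) x p : dotv (k *: x) p = k * dotv x p.
Proof. by rewrite mulr_sumr; apply: eq_bigr => i _; rewrite mxE mulrA. Qed.

Lemma dotvDr x y p : dotv p (x + y) = dotv p x + dotv p y.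
Proof. by rewrite dotvC dotvDl !(dotvC p). Qed.

Lemma dotvZr (k : R) x p : dotv p (k *: x) = k * dotv p x.
Proof. by rewrite dotvC dotvZl (dotvC p). Qed.

Lemma dotvNl x y : dotv (- x) y = - dotv x y.
Proof. by rewrite -scaleN1r dotvZl mulN1r. Qed.

Lemma dotv0l x : dotv 0 x = 0.
Proof. by rewrite -(scale0r 0) dotvZl mul0r. Qed.

Lemma dotvBl x y p : dotv (x - y) p = dotv x p - dotv y p.
Proof. by rewrite dotvDl dotvNl. Qed.

Lemma dotvBr x y p : dotv p (x - y) = dotv p x - dotv p y.
Proof. by rewrite dotvC dotvBl !(dotvC p). Qed.

Lemma coord_le_enorm x i : `|x 0 i| <= enorm x.
Proof.
rewrite -(@ler_pXn2r _ 2) ?nnegrE ?enorm_ge0// sqr_enorm real_normK ?num_real//.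
rewrite (bigD1 i)//= lerDl sumr_ge0// => j _; exact: sqr_ge0.
Qed.

Lemma enorm_eq0 x : enorm x = 0 -> x = 0.
Proof.
move=> x0; apply/rowP => i; rewrite mxE; apply/eqP; rewrite -normr_le0 -x0.
exact: coord_le_enorm.
Qed.

Lemma enormZ (k : R) x : enorm (k *: x) = `|k| * enorm x.
Proof.
apply/eqP; rewrite -(@eqrXn2 _ 2) ?mulr_ge0 ?enorm_ge0//.
by rewrite exprMn real_normK ?num_real// -!dotvv dotvZl dotvZr; apply/eqP; ring.
Qed.

Lemma enormB x y : enorm (x - y) = enorm (y - x).
Proof. by rewrite -opprB -scaleN1r enormZ normrN1 mul1r. Qed.

Lemma enorm0 : enorm (0 : 'rV[R]_n) = 0.
Proof. by rewrite -(scale0r 0) enormZ normr0 mul0r. Qed.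

Lemma cauchy_schwarz x y : dotv x y <= enorm x * enorm y.
Proof.
have [/enorm_eq0->|x0] := eqVneq (enorm x) 0.
  by rewrite dotv0l mulr_ge0 ?enorm_ge0.
have [/enorm_eq0->|y0] := eqVneq (enorm y) 0.
  by rewrite dotvC dotv0l mulr_ge0 ?enorm_ge0.
have xy0 : 0 < enorm x * enorm y by rewrite mulr_gt0 ?lt_def ?x0 ?y0 ?enorm_ge0.
have := sqr_ge0 (enorm (enorm y *: x - enorm x *: y)).
rewrite -dotvv dotvBl !dotvBr !dotvZl !dotvZr !dotvv (dotvC y x) => H.
rewrite -subr_ge0 -(pmulr_rge0 _ xy0); nra.
Qed.

Lemma enormD x y : enorm (x + y) <= enorm x + enorm y.
Proof.
rewrite -(@ler_pXn2r _ 2) ?nnegrE ?addr_ge0 ?enorm_ge0//.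
rewrite -dotvv dotvDl !dotvDr !dotvv (dotvC y x).
have := cauchy_schwarz x y; lra.
Qed.

Lemma continuous_sum_coord (T : topologicalType) (F : 'I_n -> T -> R) :
  (forall i, continuous (F i)) -> continuous (fun w => \sum_(i < n) F i w).
Proof.
by move=> cF; apply: (@continuous_big _ _ _ _ _ add_continuous) => i _; exact: cF.
Qed.

Lemma enorm_continuous : continuous (@enorm R n).
Proof.
move=> x; apply: (@continuous_comp _ _ _ _ (@Num.sqrt R)); last exact: sqrt_continuous.
apply: continuous_sum_coord => i y.
apply: (@continuous_comp _ _ _ (fun z : 'rV[R]_n => z 0 i) (fun r : R => r ^+ 2)).
  exact: coord_continuous.
exact: exprn_continuous.
Qed.

End Euclid.

Section Minimum.
Context {R : realType} {n : nat}.

(** It serves to extend a solution to negative times by its initial value, so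
    that minima may be sought among functions continuous on the whole space. *)
Lemma within_continuous_retract (X Y : topologicalType) (Z : topologicalType)
    (A : set Y) (f : Y -> Z) (h : X -> Y) :
  {within A, continuous f} -> continuous h -> (forall p, A (h p)) ->
  continuous (f \o h).
Proof.
move=> cf ch Ah p B HB.
have {}cf : forall y, A y -> f @ within A (nbhs y) --> f y.
  by apply/subspace_continuousP; exact: cf.
have H : within A (nbhs (h p)) (f @^-1` B) := cf (h p) (Ah p) B HB.
have H2 : nbhs p (fun q => A (h q) -> B (f (h q))) := ch p _ H.
by apply: filterS H2 => q /(_ (Ah q)).
Qed.

Lemma box_compact (r : R) :
  compact [set x : 'rV[R]_n | forall i : 'I_n, `[- r, r]%classic (x 0 i)].
Proof.
by apply: (@rV_compact _ _ (fun=> `[- r, r]%classic)) => _; exact: segment_compact.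
Qed.

Lemma minimum_exists (f : 'rV[R]_n -> R -> R) (T r : R) : 0 <= T ->
  continuous (fun p : 'rV[R]_n * R => f p.1 p.2) ->
  (forall x t, 0 <= t <= T -> r < enorm x -> f 0 0 <= f x t) ->
  exists x t, 0 <= t <= T /\ forall y s, 0 <= s <= T -> f x t <= f y s.
Proof.
move=> T0 cf fr; pose r' := Num.max r 0.
pose K := [set x : 'rV[R]_n | forall i, `[- r', r']%classic (x 0 i)] `*` `[0, T].
have K00 : K (0, 0).
  by split => [i|]; rewrite /= in_itv/= ?mxE ?lexx// lerNl oppr0 le_max lexx orbT.
have [|||[x t] xt H] := @compact_EVT_min _ R (fun p => f p.1 p.2) K.
- by exists (0, 0).
- by apply: compact_setX; [exact: box_compact|exact: segment_compact].
- exact: continuous_subspaceT.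
exists x, t; move: xt; rewrite inE => -[_ /=]; rewrite in_itv/= => t0T.
split=> // y s s0T.
have [rn|nr] := ltP r (enorm y).
  by rewrite (le_trans _ (fr _ _ s0T rn))//; apply: (H (0, 0)); rewrite inE.
apply: (H (y, s)); rewrite inE; split => [i|]/=; rewrite in_itv//= -ler_norml.
by rewrite (le_trans (coord_le_enorm _ _))// le_max nr.
Qed.

End Minimum.

(** * Test functions and comparison *)

(** The theorem has D = eps `^ alpha; the estimates only depend on the sizes of
    D, eps and eps / D. *)
Record cone_solution (R : realType) (n : nat) (g : R -> R) (C D eps : R)
    (u : 'rV[R]_n -> R -> R) : Prop := ConeSolution {
  cone_D_gt0 : 0 < D;
  cone_eps_gt0 : 0 < eps;
  cone_deriv : forall x t, 0 < t ->
    [/\ derivable (u x) t 1,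
        forall i, derivable (u ^~ t) x (delta_mx 0 i)
      & forall i, derivable (partial i (u ^~ t)) x (delta_mx 0 i)];
  cone_eq : forall x t, 0 < t ->
    (u x)^`()%classic t - D * laplacian (u ^~ t) x - g (u x t / eps) = 0;
  cone_cont : {within @closed_half_space R n, continuous (fun z => u z.1 z.2)};
  cone_init : forall x, u x 0 = - C * enorm x;
  cone_growth : forall T, 0 < T -> exists M, forall x t, 0 <= t <= T ->
    `|u x t| <= M * (1 + enorm x) }.

Section TestFunction.
Context {R : realType} {n : nat}.
Implicit Types (x y b : 'rV[R]_n) (r s t : R).

Lemma is_derive_line (f : 'rV[R]_n -> R) x (v : 'rV[R]_n) r :
  derivable f (r *: v + x) v ->
  is_derive r 1 (fun h => f (h *: v + x)) ('D_v f (r *: v + x)).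
Proof.
move=> df.
have E : (fun h : R => h^-1 *:
      (((fun h : R => f (h *: v + x)) \o shift r) (h%:A) - f (r *: v + x)))
    = (fun h => h^-1 *: ((f \o shift (r *: v + x)) (h *: v) - f (r *: v + x))).
  by apply/funext => h /=; rewrite [_%:A]mulr1 scalerDl addrA.
apply: DeriveDef; first by rewrite /derivable E.
by rewrite /derive E.
Qed.

(** All comparison functions have this form: the gradient is b + 2 a x and the
    Laplacian is the constant 2 a n. *)
Definition quad_test b (a : R) (th : R -> R) x t : R :=
  \sum_(i < n) (b 0 i * x 0 i + a * x 0 i ^+ 2) + th t.

Lemma quad_test_line b a th x t (i : 'I_n) r :
  quad_test b a th (r *: delta_mx 0 i + x) t =
  quad_test b a th x t + (b 0 i + 2 * a * x 0 i) * r + a * r ^+ 2.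
Proof.
rewrite /quad_test (bigD1 i)//= [in RHS](bigD1 i)//= !mxE !eqxx /= mulr1.
rewrite (eq_bigr (fun j => b 0 j * x 0 j + a * x 0 j ^+ 2)); first by ring.
by move=> j ji; rewrite !mxE (negPf ji) /= mulr0 add0r.
Qed.

Context (g : R -> R) (C D eps : R) (u : 'rV[R]_n -> R -> R).
Hypothesis sol : cone_solution g C D eps u.

Let D0 := cone_D_gt0 sol.
Let eps0 := cone_eps_gt0 sol.
Let du := cone_deriv sol.
Let equ := cone_eq sol.

Context (q dq Gam : R -> R).
Hypotheses (q0 : forall y : R, 0 < q y)
  (dqE : forall y : R, is_derive y 1 q (dq y))
  (dGam : forall y : R, is_derive y 1 Gam (q y)^-1).

Let w x t := eps * Gam (u x t / eps).

Let epsN0 : eps != 0. Proof. by rewrite gt_eqF. Qed.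
Let qN0 z : q z != 0. Proof. by rewrite gt_eqF. Qed.

Let dw_comp (phi : R -> R) r (d : R) : is_derive r 1 phi d ->
  is_derive r 1 (fun h => eps * Gam (phi h / eps)) (d / q (phi r / eps)).
Proof.
move=> dphi.
have ? : is_derive r 1 (fun h => Gam (phi h / eps)) ((q (phi r / eps))^-1 * (d / eps)).
  apply: (@is_derive1_comp _ Gam (fun h => phi h / eps)).
  by apply: is_derive_eq; rewrite /GRing.scale/=; ring.
by apply: is_derive_eq; rewrite /GRing.scale/=; field; rewrite qN0 epsN0.
Qed.

(** The function U = eps Gam (u / eps) solves
    U_t = D Lap U + (D / eps) |grad U| ^ 2 q' (u / eps) + (g / q) (u / eps), an
    equation without oscillations where (D / eps) |grad U| ^ 2 is the kap of a
    corrector. At an extremum of U minus a test function, in space and backwards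
    in time, the gradients agree and the remaining derivatives are ordered. The
    factor s treats minima (s = 1) and maxima (s = - 1) at once. *)
Lemma touching s b a th (th' : R) x t : 0 < t -> is_derive t 1 th th' ->
  (forall y, s * (w x t - quad_test b a th x t) <= s * (w y t - quad_test b a th y t)) ->
  (forall r, 0 <= r <= t ->
    s * (w x t - quad_test b a th x t) <= s * (w x r - quad_test b a th x r)) ->
  let y : R := u x t / eps in
  0 <= s * (th' - (D * (2 * a * n%:R) +
    D / eps * (\sum_(i < n) (b 0 i + 2 * a * x 0 i) ^+ 2) * dq y + g y / q y)).
Proof.
move=> t0 dth minx mint; set y : R := u x t / eps; cbv zeta.
have [->|s0] := eqVneq s 0; first by rewrite mul0r.
have [dut dux duxx] := du x t0.
have ut : is_derive t 1 (u x) ((u x)^`()%classic t).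
  by rewrite derive1E; exact/derivableP.
have time : s * ((u x)^`()%classic t / q y - th') <= 0.
  have F : is_derive t 1 (fun r => s * (w x r - quad_test b a th x r))
      (s * ((u x)^`()%classic t / q y - th')).
    have := dw_comp ut => ?; rewrite /w /quad_test.
    by apply: is_derive_eq; rewrite /GRing.scale/=; ring.
  exact: (is_derive_le0_left t0 F mint).
pose L i := partial i (partial i (u ^~ t)) x.
have space i : 0 <= s * (L i / q y - (b 0 i + 2 * a * x 0 i) ^+ 2 / eps * dq y - 2 * a).
  pose e : 'rV[R]_n := delta_mx 0 i.
  pose phi (r : R) := u (r *: e + x) t.
  pose phi' (r : R) := partial i (u ^~ t) (r *: e + x).
  have dphi r : is_derive r 1 phi (phi' r).
    by have [_ d1 _] := du (r *: e + x) t0; exact: (is_derive_line (d1 i)).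
  have dphi' : is_derive (0 : R) 1 phi' (L i).
    have := @is_derive_line (partial i (u ^~ t)) x e 0.
    by rewrite scale0r add0r; apply; exact: duxx.
  set be := b 0 i + 2 * a * x 0 i.
  pose F r := s * (eps * Gam (phi r / eps) - (quad_test b a th x t + be * r + a * r ^+ 2)).
  pose F' r := s * (phi' r / q (phi r / eps) - (be + 2 * a * r)).
  have dF r : is_derive r 1 F (F' r).
    have := dw_comp (dphi r) => ?.
    by apply: is_derive_eq; rewrite /F' /GRing.scale/=; ring.
  have phi0 : phi 0 = u x t by rewrite /phi scale0r add0r.
  have qphi : is_derive (0 : R) 1 (fun r => (q (phi r / eps))^-1)
     (- q y ^- 2 * (dq y * (phi' 0 / eps))).
    have ? : is_derive (0 : R) 1 (fun r => q (phi r / eps)) (dq y * (phi' 0 / eps)).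
      apply: (@is_derive1_comp _ q (fun h => phi h / eps)); first by rewrite phi0; exact: dqE.
      by have := dphi 0 => ?; apply: is_derive_eq; rewrite /GRing.scale/=; ring.
    by have := @is_deriveV _ (fun r => q (phi r / eps)) 0 _ 1 (qN0 _) _; rewrite phi0; apply.
  have dF' : is_derive (0 : R) 1 F'
     (s * (L i / q y - phi' 0 * (q y ^- 2 * (dq y * (phi' 0 / eps))) - 2 * a)).
    by apply: is_derive_eq; rewrite phi0 /GRing.scale/= -/y; ring.
  have Fmin r : F 0 <= F r.
    rewrite /F phi0 mulr0 expr0n/= mulr0 !addr0.
    by have := minx (r *: e + x); rewrite quad_test_line.
  have : F' 0 = 0 := is_derive_min (dF 0) Fmin.
  rewrite /F' phi0 -/y mulr0 addr0 => /eqP; rewrite mulf_eq0 (negPf s0) /= subr_eq0.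
  move=> /eqP phi'0; have {}phi'0 : phi' 0 = be * q y by rewrite -phi'0 divfK.
  have := is_derive2_min dF dF' Fmin; rewrite phi'0.
  suff -> : be * q y * (q y ^- 2 * (dq y * (be * q y / eps))) = be ^+ 2 / eps * dq y by [].
  by field; rewrite qN0 epsN0.
have sumspace : 0 <= D * \sum_(i < n)
    (s * (L i / q y - (b 0 i + 2 * a * x 0 i) ^+ 2 / eps * dq y - 2 * a)).
  by rewrite mulr_ge0 ?(ltW D0)// sumr_ge0.
move: sumspace; rewrite -mulr_sumr !sumrB.
rewrite -!mulr_suml sumr_const card_ord -[_ *+ n]mulr_natr.
have := equ x t0; rewrite -/y /laplacian -/(L _).
rewrite (eq_bigr L)//; set S := \sum_(i < n) L i; set Q := \sum_(i < n) _ => e.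
have utE : (u x)^`()%classic t = D * S + g y by lra.
rewrite utE in time => H.
have -> : s * (th' - (D * (2 * a * n%:R) + D / eps * Q * dq y + g y / q y)) =
  D * (s * (S / q y - Q / eps * dq y - 2 * a * n%:R)) - s * ((D * S + g y) / q y - th').
  by ring.
lra.
Qed.

End TestFunction.

Lemma continuous_mkpair (X Y Z : topologicalType) (f : X -> Y) (h : X -> Z) :
  continuous f -> continuous h -> continuous (fun x => (f x, h x)).
Proof. by move=> cf ch p; apply: cvg_pair; [exact: cf|exact: ch]. Qed.

Lemma continuous_fst (Y Z : topologicalType) : continuous (@fst Y Z).
Proof. by move=> p; exact: cvg_fst. Qed.

Lemma continuous_snd (Y Z : topologicalType) : continuous (@snd Y Z).
Proof. by move=> p; exact: cvg_snd. Qed.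

Lemma continuous_o (X Y Z : topologicalType) (f : X -> Y) (h : Y -> Z) :
  continuous f -> continuous h -> continuous (fun x => h (f x)).
Proof. by move=> cf ch p; apply: continuous_comp; [exact: cf|exact: ch]. Qed.

Lemma continuous_max0 (R : realType) : continuous (Num.max (0 : R)).
Proof.
apply: (@lipschitz_cont _ _ 1) => r s; rewrite mul1r ler_norml.
have := ler_norm (r - s); have := ler_norm (s - r); rewrite (distrC s r).
by case: (leP 0 r) => ?; case: (leP 0 s) => ?; lra.
Qed.

Section Comparison.
Context {R : realType} {n : nat}.
Implicit Types (x y b : 'rV[R]_n) (r s t : R).

Lemma continuous_clamped (u : 'rV[R]_n -> R -> R) :
  {within @closed_half_space R n, continuous (fun z => u z.1 z.2)} ->
  continuous (fun p : 'rV[R]_n * R => u p.1 (Num.max 0 p.2)).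
Proof.
move=> uc; pose h (p : 'rV[R]_n * R) := (p.1, Num.max 0 p.2).
have cm := @continuous_max0 R.
apply: (@within_continuous_retract _ _ _ _ _ h uc).
  apply: continuous_mkpair; first exact: continuous_fst.
  by apply: continuous_o cm; exact: continuous_snd.
by move=> p; rewrite /closed_half_space /= le_max lexx.
Qed.

Lemma continuous_quad_test b a th : continuous th ->
  continuous (fun p : 'rV[R]_n * R => quad_test b a th p.1 p.2).
Proof.
move=> cth p; apply: cvgD; last first.
  by move: p; apply: continuous_o cth; exact: continuous_snd.
have cc (i : 'I_n) : continuous (fun p : 'rV[R]_n * R => p.1 0 i).
  apply: (@continuous_o _ _ _ fst (fun x : 'rV[R]_n => x 0 i)).
    exact: continuous_fst.
  exact: coord_continuous.
apply: continuous_sum_coord => i z; apply: cvgD.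
  by apply: cvgM; [exact: cvg_cst|exact: cc].
apply: cvgM; first exact: cvg_cst.
by under eq_fun do rewrite expr2; rewrite expr2; apply: cvgM; exact: cc.
Qed.

Context (g : R -> R) (C D eps : R) (u : 'rV[R]_n -> R -> R).
Hypothesis sol : cone_solution g C D eps u.
Context (q dq Gam : R -> R).
Hypotheses (q0 : forall y : R, 0 < q y)
  (dqE : forall y : R, is_derive y 1 q (dq y))
  (dGam : forall y : R, is_derive y 1 Gam (q y)^-1).

(** Coercivity yields a minimum point, and strictness at minimum points forces
    it to the initial time. *)
Lemma comparison s b a (th th' : R -> R) (T rho m : R) f : 0 <= T ->
  (forall t, is_derive t 1 th (th' t)) ->
  (forall x t, f x t = s * (eps * Gam (u x t / eps) - quad_test b a th x t)) ->
  (forall x t, 0 <= t <= T -> rho < enorm x -> f 0 0 <= f x t) ->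
  (forall x t, 0 < t <= T -> (forall y r, 0 <= r <= T -> f x t <= f y r) ->
    s * (th' t - (D * (2 * a * n%:R) +
      D / eps * (\sum_(i < n) (b 0 i + 2 * a * x 0 i) ^+ 2) * dq (u x t / eps)
      + g (u x t / eps) / q (u x t / eps))) < 0) ->
  (forall x, m <= f x 0) -> forall x t, 0 <= t <= T -> m <= f x t.
Proof.
move=> T0 dth fE coer strict init x t tT.
pose F x t := f x (Num.max 0 t) + s * (th (Num.max 0 t) - th t).
have FE y r : 0 <= r -> F y r = f y r.
  by move=> r0; rewrite /F max_r// subrr mulr0 addr0.
have cth : continuous th by move=> r; exact: is_derive1_cont (dth r).
have cG : continuous Gam by move=> r; exact: is_derive1_cont (dGam r).
have cF : continuous (fun p : 'rV[R]_n * R => F p.1 p.2).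
  have -> : (fun p : 'rV[R]_n * R => F p.1 p.2) =
      (fun p => s * (eps * Gam (u p.1 (Num.max 0 p.2) / eps)
        - quad_test b a th p.1 p.2)).
    by apply/funext => p; rewrite /F fE /quad_test; ring.
  move=> p; apply: cvgM; first exact: cvg_cst.
  apply: cvgB; last exact: continuous_quad_test.
  apply: cvgM; first exact: cvg_cst.
  move: p; apply: continuous_o cG => p.
  by apply: cvgM; [exact: (continuous_clamped (cone_cont sol))|exact: cvg_cst].
have [|x0 [t0 [/andP[t00 t0T] mn]]] := minimum_exists T0 cF (r := rho).
  by move=> y r rT yr; rewrite !FE//; [exact: coer|case/andP: rT].
have {}mn y r : 0 <= r <= T -> f x0 t0 <= f y r.
  by move=> rT; rewrite -!FE//; [exact: mn|case/andP: rT].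
rewrite (le_trans _ (mn _ _ tT))//.
move: t00; rewrite le_eqVlt => /predU1P[<-//|t00].
have t0T' : 0 < t0 <= T by rewrite t00.
have := strict x0 t0 t0T' mn; rewrite ltNge => /negP; case.
apply: (touching sol q0 dqE dGam t00 (dth t0)).
- by move=> y; rewrite -!fE; apply: mn; rewrite ltW.
- by move=> r /andP[r0 rt]; rewrite -!fE; apply: mn; rewrite r0 (le_trans rt).
Qed.

End Comparison.

Lemma affine_le_quadratic (R : realType) (M A : R) : 0 < A ->
  exists rho, forall r : R, rho < r -> M * (1 + r) <= A * r ^+ 2.
Proof.
move=> A0; exists (1 + 2 * `|M| / A) => r rr.
have h0 : 0 <= 2 * `|M| / A by rewrite !mulr_ge0// invr_ge0 ltW.
have r1 : 1 <= r by lra.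
have : 2 * `|M| / A <= r by lra.
rewrite ler_pdivrMr// [r * A]mulrC => hr.
have r0 : 0 <= r by lra.
have k1 : M * (1 + r) <= `|M| * (2 * r).
  by rewrite (le_trans (ler_norm _))// normrM ler_wpM2l// ger0_norm; lra.
have k2 := ler_wpM2r r0 hr.
by rewrite expr2; lra.
Qed.

(** * Upper bounds *)

Lemma le_vanishing (R : realType) (a b K : R) :
  (forall mu, 0 < mu <= 1 -> a <= b + mu * K) -> a <= b.
Proof.
move=> H; apply/ler_addgt0Pr => e e0.
have K1 : 0 < `|K| + e by rewrite ltr_wpDl.
have mu0 : 0 < e / (`|K| + e) by rewrite divr_gt0.
have mu1 : e / (`|K| + e) <= 1 by rewrite ler_pdivrMr// mul1r lerDr.
have {}H : a <= b + e / (`|K| + e) * K by apply: H; rewrite mu0 mu1.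
rewrite (le_trans H)// lerD2l mulrAC ler_pdivrMr// ler_pM2l//.
by rewrite (le_trans (ler_norm _))// lerDl ltW.
Qed.

Lemma quad_testE (R : realType) n (b : 'rV[R]_n) (a : R) th x t :
  quad_test b a th x t = dotv b x + a * enorm x ^+ 2 + th t.
Proof. by rewrite /quad_test big_split/= -mulr_sumr -sqr_enorm. Qed.

Lemma scaled_near (R : realType) (Gam : R -> R) (eps : R) : 0 < eps ->
  (forall y, `|Gam y - y| <= 1) ->
  forall z, `|eps * Gam (z / eps) - z| <= eps.
Proof.
move=> eps0 Gam_near z.
have -> : eps * Gam (z / eps) - z = eps * (Gam (z / eps) - z / eps).
  by field; rewrite gt_eqF.
by rewrite normrM gtr0_norm// ler_piMr// ltW.
Qed.

Section Barriers.
Context {R : realType} {n : nat}.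
Implicit Types (x y b p : 'rV[R]_n) (r s t : R).
Context (g : R -> R) (m1 m2 L : R).
Hypothesis gF : forcing g m1 m2 L.
Context (C D eps : R) (u : 'rV[R]_n -> R -> R).
Hypothesis C0 : 0 < C.
Hypothesis sol : cone_solution g C D eps u.

Let D0 := cone_D_gt0 sol.
Let eps0 := cone_eps_gt0 sol.
Let u_init := cone_init sol.
Let u_growth := cone_growth sol.
Let g_bnd := forcing_bnd gF.
Let g_gt0 := forcing_gt0 gF.
Let m20 := forcing_m2_gt0 gF.

Let epsN0 : eps != 0. Proof. by rewrite gt_eqF. Qed.
Let idD (y : R) : is_derive y 1 (fun z : R => z) (1^-1).
Proof. by rewrite invr1; exact: is_derive_id. Qed.
Let oneD (y : R) : is_derive y 1 (fun _ : R => 1 : R) 0.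
Proof. exact: is_derive_cst. Qed.
Let one_gt0 (y : R) : 0 < (fun _ : R => 1 : R) y. Proof. exact: ltr01. Qed.

Let dlin (k k0 t : R) : is_derive t 1 (fun t => k0 + k * t) k.
Proof. by apply: is_derive_eq; rewrite /GRing.scale/=; ring. Qed.

(** The paraboloid touches the initial cone from below along |x| = nu, and its
    quadratic decay beats the linear growth of u. *)
Lemma lower_barrier (nu : R) x t : 0 < nu -> 0 <= t ->
  - (C / 2) * (enorm x ^+ 2 / nu + nu) - D * C * n%:R / nu * t <= u x t.
Proof.
move=> nu0 t0; set K := D * C * n%:R / nu.
have K0 : 0 <= K by rewrite /K !mulr_ge0 ?invr_ge0// ltW.
have [|M uM] := u_growth (T := t + 1); first by rewrite ltr_wpDl.
have A0 : 0 < C / 2 / nu by rewrite !divr_gt0.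
have [rho rhoP] := affine_le_quadratic M A0.
have T0 : 0 <= t + 1 by rewrite addr_ge0.
pose f y r := u y r + C / 2 / nu * enorm y ^+ 2 + (C / 2 * nu + K * r).
suff : 0 <= f x t by rewrite /f; lra.
have fE y r : f y r = 1 * (eps * (u y r / eps) -
    quad_test 0 (- (C / 2 / nu)) (fun t => - (C / 2 * nu) + - K * t) y r).
  rewrite quad_testE dotv0l mul1r mulrC divfK// /f; ring.
have u00 : u 0 0 = 0 by rewrite u_init enorm0 mulr0.
apply: (comparison sol one_gt0 oneD idD T0 (dlin (- K) _) fE (rho := rho)).
- move=> y r rT /rhoP.
  have := uM y r rT; rewrite ler_norml => /andP[h1 _] h2.
  have /andP[r0 _] := rT; have := mulr_ge0 K0 r0.
  rewrite /f u00 enorm0 expr0n /= !mulr0; lra.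
- move=> y r _ _; rewrite mulr0 divr1 addr0 mul1r.
  rewrite (_ : D * _ = - K); first by have := g_gt0 (u y r / eps); lra.
  by rewrite /K; field; rewrite gt_eqF.
- move=> y; rewrite /f u_init mulr0 addr0.
  have -> : - C * enorm y + C / 2 / nu * enorm y ^+ 2 + C / 2 * nu =
    C / 2 / nu * (enorm y - nu) ^+ 2 by field; rewrite gt_eqF.
  by rewrite mulr_ge0 ?sqr_ge0// ltW.
- by rewrite t0 lerDl ler01.
Qed.

(** The barrier with nu = |x| is exact at x. Near the vertex nu is kept away
    from 0, because the cost of the barrier grows like D / nu. *)
Lemma lower_apriori (nu : R) x t : 0 < nu -> 0 <= t ->
  - C * enorm x - C * nu - D * C * n%:R / nu * t <= u x t.
Proof.
move=> nu0 t0; have [xnu|nux] := leP (enorm x) nu.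
  rewrite (le_trans _ (lower_barrier x nu0 t0))// lerD2r.
  have x0 := enorm_ge0 x.
  have e : enorm x ^+ 2 / nu <= enorm x.
    by rewrite ler_pdivrMr// expr2 ler_wpM2l.
  have C2 : 0 <= C / 2 by rewrite divr_ge0// ltW.
  have h1 := ler_wpM2l C2 e; have h2 := mulr_ge0 C2 (ltW nu0).
  have h3 := mulr_ge0 C2 x0; lra.
have x0 : 0 < enorm x := lt_trans nu0 nux.
rewrite (le_trans _ (lower_barrier x x0 t0))//.
have -> : enorm x ^+ 2 / enorm x = enorm x by field; rewrite gt_eqF.
have h1 : D * C * n%:R / enorm x * t <= D * C * n%:R / nu * t.
  have DC0 : 0 <= D * C * n%:R by rewrite !mulr_ge0// ltW.
  by rewrite ler_wpM2r// ler_wpM2l// lef_pV2 ?posrE// ltW.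
have := mulr_ge0 (ltW C0) (ltW nu0); lra.
Qed.

(** A penalty mu |x| ^ 2 provides coercivity and disappears as mu tends to 0. *)
Lemma upper_barrier p x t : enorm p <= C -> 0 <= t ->
  u x t <= - dotv p x + m2 * t.
Proof.
move=> pC t0; pose k := enorm x ^+ 2 + 2 * D * n%:R * t + t.
apply: (@le_vanishing _ _ _ k) => mu /andP[mu0 _].
have [|M uM] := u_growth (T := t + 1); first by rewrite ltr_wpDl.
have [rho rhoP] := affine_le_quadratic (M + C) mu0.
have T0 : 0 <= t + 1 by rewrite addr_ge0.
pose K := m2 + 2 * D * mu * n%:R + mu.
have K0 : 0 <= K by rewrite /K !addr_ge0 ?mulr_ge0// ltW.
pose f y r := - u y r - dotv p y + mu * enorm y ^+ 2 + K * r.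
suff : 0 <= f x t by rewrite /f /K /k; lra.
have fE y r : f y r = -1 * (eps * (u y r / eps) -
    quad_test (- p) mu (fun t => 0 + K * t) y r).
  rewrite quad_testE dotvNl [eps * _]mulrC divfK// /f; ring.
have u00 : u 0 0 = 0 by rewrite u_init enorm0 mulr0.
have pn y : dotv p y <= C * enorm y.
  by rewrite (le_trans (cauchy_schwarz _ _))// ler_wpM2r// enorm_ge0.
have p0 : dotv p 0 = 0 by rewrite dotvC dotv0l.
apply: (comparison sol one_gt0 oneD idD T0 (dlin K 0) fE (rho := rho)).
- move=> y r rT /rhoP.
  have := uM y r rT; rewrite ler_norml => /andP[_ h1] h2.
  have /andP[r0 _] := rT; have := mulr_ge0 K0 r0; have := pn y.
  have := enorm_ge0 y; rewrite /f u00 p0 enorm0 expr0n /= !mulr0; have := C0; lra.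
- move=> y r _ _; rewrite mulr0 divr1 addr0.
  have /andP[_ g2] := g_bnd (u y r / eps); rewrite /K; lra.
- move=> y; rewrite /f u_init mulr0 addr0.
  have := pn y; have := mulr_ge0 (ltW mu0) (sqr_ge0 (enorm y)); lra.
- by rewrite t0 lerDl ler01.
Qed.

(** The cone is the minimum of the affine functions of slope C. *)
Lemma upper_apriori x t : 0 <= t -> u x t <= - C * enorm x + m2 * t.
Proof.
move=> t0; have [x0|x0] := eqVneq (enorm x) 0.
  have := @upper_barrier 0 x t; rewrite enorm0 => /(_ (ltW C0) t0).
  by rewrite dotv0l x0 oppr0 mulr0.
have xp : 0 < enorm x by rewrite lt_def x0 enorm_ge0.
have := @upper_barrier ((C / enorm x) *: x) x t _ t0.
rewrite enormZ dotvZl dotvv gtr0_norm ?divr_gt0// divfK// lexx => /(_ isT).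
have -> : C / enorm x * enorm x ^+ 2 = C * enorm x by field.
by rewrite mulNr.
Qed.

Section Upper.
Context (q dq Gam : R -> R).
Hypotheses (q0 : forall y : R, 0 < q y)
  (dqE : forall y : R, is_derive y 1 q (dq y))
  (dGam : forall y : R, is_derive y 1 Gam (q y)^-1)
  (Gam_near : forall y : R, `|Gam y - y| <= 1).

(** As |p| < C, the bound by the cone already makes the difference coercive: no
    penalty is needed, and the gradient of the test function is exactly - p, as
    a corrector with a fixed kap requires. *)
Lemma upper_linear p (tau : R) x t : enorm p < C -> 0 <= tau ->
  (forall y : R, D / eps * enorm p ^+ 2 * dq y + g y / q y < tau) ->
  0 <= t -> u x t <= - dotv p x + tau * t + 2 * eps.
Proof.
move=> pC tau0 strict t0.
pose w y r := eps * Gam (u y r / eps).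
pose f y r := tau * r - dotv p y - w y r.
have wu y r : u y r - eps <= w y r <= u y r + eps by rewrite -ler_distl scaled_near.
suff : - eps <= f x t by have := wu x t; rewrite /f; lra.
have fE y r : f y r = -1 * (eps * Gam (u y r / eps) -
    quad_test (- p) 0 (fun t => 0 + tau * t) y r).
  by rewrite quad_testE dotvNl /f /w; ring.
have u00 : u 0 0 = 0 by rewrite u_init enorm0 mulr0.
have pn y : dotv p y <= enorm p * enorm y := cauchy_schwarz _ _.
have p0 : dotv p 0 = 0 by rewrite dotvC dotv0l.
have Cp : 0 < C - enorm p by rewrite subr_gt0.
pose rho := (m2 * t + 2 * eps) / (C - enorm p).
apply: (comparison sol q0 dqE dGam t0 (dlin tau 0) fE (rho := rho)).
- move=> y r /andP[r0 rt]; rewrite /rho ltr_pdivrMr// => h.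
  have := wu 0 0; have := wu y r; have := upper_apriori y r0; have := pn y.
  have := mulr_ge0 tau0 r0; have := ler_wpM2l (ltW m20) rt.
  by rewrite /f u00 p0 mulr0; lra.
- move=> y r _ _; rewrite mulr0 !mul0r mulr0 add0r.
  under eq_bigr do rewrite mul0r addr0 mxE sqrrN.
  rewrite -sqr_enorm; have := strict (u y r / eps); lra.
- move=> y; rewrite /f mulr0; have := wu y 0; rewrite u_init.
  have := pn y; have := ler_wpM2r (enorm_ge0 y) (ltW pC); lra.
- by rewrite t0 lexx.
Qed.

End Upper.

(** For p = 0 the diffusive term disappears, and the corrector for a small kap
    turns g into c - kap q', which is harm_mean g up to O(kap). *)
Lemma upper_harmonic x t : 0 <= t -> u x t <= harm_mean g * t + 2 * eps.
Proof.
move=> t0; pose B := L * (m2 / m1) / m1.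
have B0 : 0 <= B.
  rewrite /B !mulr_ge0 ?invr_ge0 ?(ltW m20) ?(ltW (forcing_m1_gt0 gF))//.
  exact: forcing_L_ge0 gF.
have h0 := harm_mean_gt0 gF.
apply: (@le_vanishing _ _ _ ((2 * B + 1) * t)) => mu /andP[mu0 _].
have [c [q [Gam cor]]] := corrector_exists gF mu0.
have cI : c - mu * B <= harm_mean g := corrector_harm_ge gF cor.
pose tau := harm_mean g + mu * (2 * B + 1).
have -> : harm_mean g * t + 2 * eps + mu * ((2 * B + 1) * t) =
   - dotv 0 x + tau * t + 2 * eps.
  by rewrite dotv0l /tau; ring.
have tau0 : 0 <= tau.
  rewrite /tau addr_ge0 ?(ltW h0)//.
  by apply: mulr_ge0; [exact: ltW|lra].
apply: (upper_linear (corrector_gt0 cor) (corrector_eq cor) (corrector_prim cor)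
  (corrector_prim_near cor)) => //.
- by rewrite enorm0.
- move=> y; rewrite enorm0 expr0n/= mulr0 mul0r add0r.
  set d := (c - g y / q y) / mu.
  have -> : g y / q y = c - mu * d by rewrite /d; field; rewrite !gt_eqF ?(corrector_gt0 cor).
  have : `|d| <= B := corrector_deriv_le2 gF cor y.
  rewrite ler_norml => /andP[d1 _]; have := ler_wpM2l (ltW mu0) d1.
  rewrite /tau; lra.
Qed.

(** For a slope k < C, the corrector with kap = (D / eps) k ^ 2 has a speed at most
    arith_mean g; then k tends to C. *)
Lemma upper_arithmetic x t : 0 <= t -> u x t <= - C * enorm x + arith_mean g * t + 2 * eps.
Proof.
move=> t0; have hA := harm_le_arith gF; set A := arith_mean g in hA *.
have [x0|x0] := eqVneq (enorm x) 0.
  rewrite x0 mulr0 add0r (le_trans (upper_harmonic x t0))// lerD2r.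
  by rewrite ler_wpM2r.
have xp : 0 < enorm x by rewrite lt_def x0 enorm_ge0.
have A0 : 0 < A by exact: lt_le_trans (harm_mean_gt0 gF) hA.
apply: (@le_vanishing _ _ _ (C / 2 * enorm x + t)) => mu /andP[mu0 mu1].
pose k := C * (1 - mu / 2).
have k0 : 0 < k by rewrite mulr_gt0//; lra.
pose p := (k / enorm x) *: x.
have pE : enorm p = k by rewrite enormZ gtr0_norm ?divr_gt0// divfK.
have pxE : dotv p x = k * enorm x by rewrite dotvZl dotvv; field.
have kap0 : 0 < D / eps * k ^+ 2 by rewrite mulr_gt0 ?divr_gt0 ?exprn_gt0.
have [c [q [Gam cor]]] := corrector_exists gF kap0.
have /andP[_] := corrector_arith gF cor; rewrite -/A => cA.
have -> : - C * enorm x + A * t + 2 * eps + mu * (C / 2 * enorm x + t) =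
  - dotv p x + (A + mu) * t + 2 * eps by rewrite pxE /k; field.
apply: (upper_linear (corrector_gt0 cor) (corrector_eq cor) (corrector_prim cor)
  (corrector_prim_near cor)) => //.
- rewrite pE /k; have := mulr_gt0 C0 mu0; lra.
- by rewrite addr_ge0 ?ltW.
- move=> y; rewrite pE mulrC divfK ?gt_eqF//; lra.
Qed.

End Barriers.

(** * The limit profile *)

Section Profile.
Context {R : realType} {n : nat}.
Implicit Types (x y : 'rV[R]_n) (s t : R).
Context (C A h : R).
Hypotheses (C0 : 0 < C) (h0 : 0 < h) (hA : h <= A).

(** The limit function, with the slope of its cone as a parameter: the lower
    bound uses cones slightly steeper than the initial one. *)
Definition profile y s : R := Num.min (- C * enorm y + A * s) (h * s).

Let edge := (A - h) / C.
Let edge0 : 0 <= edge. Proof. by rewrite divr_ge0 ?subr_ge0// ltW. Qed.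

Lemma profile_le_time y s (sig : R) : 0 <= sig ->
  profile y s - A * sig <= profile y (s - sig).
Proof.
move=> sig0; have hs := ler_wpM2r sig0 hA; rewrite /profile le_min.
have := ge_min (- C * enorm y + A * s) (- C * enorm y + A * s) (h * s).
have := ge_min (h * s) (- C * enorm y + A * s) (h * s).
rewrite !lexx orbT /= => h1 h2; apply/andP; split; lra.
Qed.

(** Going back in time by sig while pulling y towards the vertex at the speed
    (A - h) / C of the edge of the plateau lowers each of the two branches of the
    profile by exactly h sig. *)
Lemma profile_le_shrink y s : 0 < s -> exists e : 'rV[R]_n, enorm e <= 1 /\
  exists2 sig0 : R, 0 < sig0 & forall sig, 0 <= sig <= sig0 ->
    profile y s - h * sig <= profile (y - (sig * edge) *: e) (s - sig).
Proof.
move=> s0; have := ge_min (- C * enorm y + A * s) (- C * enorm y + A * s) (h * s).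
have := ge_min (h * s) (- C * enorm y + A * s) (h * s).
rewrite !lexx orbT /= -/(profile y s) => h1 h2.
have [y0|y0] := eqVneq (enorm y) 0.
  exists 0; rewrite enorm0 ler01; split=> //; exists s => // sig /andP[g0 gs].
  rewrite scaler0 subr0 {2}/profile y0 le_min; apply/andP; split; last by lra.
  have : h * (s - sig) <= A * (s - sig) by rewrite ler_wpM2r// subr_ge0.
  lra.
have yp : 0 < enorm y by rewrite lt_def y0 enorm_ge0.
have k1 : 0 < edge + 1 by rewrite ltr_wpDl.
exists ((enorm y)^-1 *: y); split.
  by rewrite enormZ gtr0_norm ?invr_gt0// mulVf.
exists (enorm y / (edge + 1)); first by rewrite divr_gt0.
move=> sig /andP[g0]; rewrite ler_pdivlMr// => gy.
have gk : sig * edge <= enorm y by lra.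
have -> : y - (sig * edge) *: ((enorm y)^-1 *: y) = (1 - sig * edge / enorm y) *: y.
  by rewrite scalerA scalerBl scale1r.
have E : enorm ((1 - sig * edge / enorm y) *: y) = enorm y - sig * edge.
  rewrite enormZ ger0_norm; first by field.
  by rewrite subr_ge0 ler_pdivrMr// mul1r.
have Ck : C * edge = A - h by rewrite /edge; field; rewrite gt_eqF.
rewrite {2}/profile E le_min; apply/andP; split; last by lra.
have -> : - C * (enorm y - sig * edge) = - C * enorm y + sig * (C * edge) by ring.
by rewrite Ck; lra.
Qed.

Lemma le_vanishing_scaled (X Y K sig0 : R) : 0 < sig0 ->
  (forall sig, 0 < sig <= sig0 -> sig * X <= sig * Y + sig ^+ 2 * K) -> X <= Y.
Proof.
move=> s0 H; apply: (@le_vanishing _ _ _ (sig0 * K)) => mu /andP[m0 m1].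
have ms : 0 < mu * sig0 by rewrite mulr_gt0.
have := H (mu * sig0); rewrite ms ler_piMl ?(ltW s0)// => /(_ isT).
have -> : mu * sig0 * Y + (mu * sig0) ^+ 2 * K =
  mu * sig0 * (Y + mu * (sig0 * K)) by ring.
by rewrite ler_pM2l.
Qed.

(** The paraboloid touches the profile at (y0, s0) with time slope
    tau = - 2 M (t0 - s0) and a gradient of length 2 M |x0 - y0|. Going back in
    time alone gives tau <= A - del; following the edge of the plateau gives the
    second bound, which is the sharp one for small gradients. *)
Lemma profile_superdifferential (M del T : R) x0 t0 y0 s0 :
  0 < M -> 0 < s0 <= T ->
  (forall y s, 0 <= s <= T ->
    - profile y0 s0 + del * s0 + M * enorm (x0 - y0) ^+ 2 + M * (t0 - s0) ^+ 2
    <= - profile y s + del * s + M * enorm (x0 - y) ^+ 2 + M * (t0 - s) ^+ 2) ->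
  - 2 * M * (t0 - s0) <= A - del /\
  - 2 * M * (t0 - s0) <= h - del + 2 * M * edge * enorm (x0 - y0).
Proof.
move=> M0 /andP[s0p s0T] mn; split.
  apply: (@le_vanishing_scaled _ _ M s0 s0p) => sig /andP[g0 gs].
  have := mn y0 (s0 - sig); rewrite subr_ge0 gs /= lerBlDr (le_trans s0T) ?lerDl ?(ltW g0)//.
  move=> /(_ isT); have := profile_le_time y0 s0 (ltW g0).
  have -> : (t0 - (s0 - sig)) ^+ 2 = (t0 - s0) ^+ 2 + 2 * sig * (t0 - s0) + sig ^+ 2 by ring.
  lra.
have [e [e1 [sig0 sig00 He]]] := profile_le_shrink y0 s0p.
have m0 : 0 < Num.min sig0 s0 by rewrite lt_min sig00.
apply: (@le_vanishing_scaled _ _ (M * edge ^+ 2 + M) _ m0) => sig /andP[g0].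
rewrite le_min => /andP[gs gs0].
have := He sig; rewrite (ltW g0) gs => /(_ isT).
have := mn (y0 - (sig * edge) *: e) (s0 - sig).
rewrite subr_ge0 gs0 /= lerBlDr (le_trans s0T) ?lerDl ?(ltW g0)// => /(_ isT).
have -> : (t0 - (s0 - sig)) ^+ 2 = (t0 - s0) ^+ 2 + 2 * sig * (t0 - s0) + sig ^+ 2 by ring.
have sk : 0 <= sig * edge by rewrite mulr_ge0 ?(ltW g0).
have D1 : enorm (x0 - (y0 - (sig * edge) *: e)) <= enorm (x0 - y0) + sig * edge.
  rewrite opprB addrCA addrC (le_trans (enormD _ _))// lerD2l enormZ ger0_norm//.
  by rewrite ler_piMr.
have D2 : enorm (x0 - (y0 - (sig * edge) *: e)) ^+ 2 <= (enorm (x0 - y0) + sig * edge) ^+ 2.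
  by rewrite lerXn2r ?nnegrE ?addr_ge0 ?enorm_ge0.
have := ler_wpM2l (ltW M0) D2.
set W := enorm (x0 - (y0 - _)) ^+ 2.
have -> : M * (enorm (x0 - y0) + sig * edge) ^+ 2 = M * enorm (x0 - y0) ^+ 2 +
  sig * (2 * M * edge * enorm (x0 - y0)) + sig ^+ 2 * (M * edge ^+ 2) by ring.
lra.
Qed.

End Profile.

(** * Doubling of variables *)

Section Doubling.
Context {R : realType} {n : nat}.
Implicit Types (x y : 'rV[R]_n) (s t : R).

Lemma profile_cont (C A h : R) :
  continuous (fun z : 'rV[R]_n * R => profile C A h z.1 z.2).
Proof.
have cm := @continuous_max0 R.
pose a (z : 'rV[R]_n * R) := - C * enorm z.1 + A * z.2.
pose b (z : 'rV[R]_n * R) := h * z.2.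
have -> : (fun z : 'rV[R]_n * R => profile C A h z.1 z.2) =
    (fun z => a z - Num.max 0 (a z - b z)).
  apply/funext => z; rewrite /profile -/(a z) -/(b z).
  by case: (leP (a z) (b z)) => ?; case: (leP 0 (a z - b z)) => ?; lra.
have ca : continuous a.
  move=> z; apply: cvgD; apply: cvgM; first exact: cvg_cst.
  - by apply: continuous_o (@enorm_continuous R n) z; exact: continuous_fst.
  - exact: cvg_cst.
  - exact: continuous_snd.
have cb : continuous b.
  by move=> z; apply: cvgM; [exact: cvg_cst|exact: continuous_snd].
move=> z; apply: cvgB; first exact: ca.
by move: z; apply: continuous_o cm => z; apply: cvgB; [exact: ca|exact: cb].
Qed.

Context (u : 'rV[R]_n -> R -> R) (C Cp A h del eta M T : R).
Hypotheses (C0 : 0 < C) (CCp : C < Cp) (A0 : 0 < A) (eta0 : 0 < eta)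
  (M0 : 0 < M) (T0 : 0 <= T) (del0 : 0 <= del).
Hypothesis uc : {within @closed_half_space R n, continuous (fun z => u z.1 z.2)}.
Hypothesis u_low : forall x t, 0 <= t <= T -> - C * enorm x - eta / 2 <= u x t.

(** At a minimum, the penalty gives paraboloids touching u from below in (x, t)
    and profile - del s from above in (y, s), with the same slopes at the two
    contact points. *)
Definition doubled x t y s : R :=
  u x t - profile Cp A h y s + del * s + M * enorm (x - y) ^+ 2 + M * (t - s) ^+ 2.

Lemma doubled_low x t y s : 0 <= t <= T -> 0 <= s ->
  - C * enorm x + Cp * enorm y - A * s - eta / 2
    + M * enorm (x - y) ^+ 2 + M * (t - s) ^+ 2 <= doubled x t y s.
Proof.
move=> tT s0; have := u_low x tT; rewrite /doubled.
have : profile Cp A h y s <= - Cp * enorm y + A * s by rewrite /profile ge_min lexx.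
have := mulr_ge0 del0 s0; lra.
Qed.

(** The slope Cp of the profile exceeds the slope C of the cone below u: their
    difference controls y, and the quadratic term controls x - y. *)
Lemma doubled_coercive x t y s : 0 <= t <= T -> 0 <= s <= T ->
  (Cp - C) * (enorm y + enorm (x - y)) - (Cp ^+ 2 / (4 * M) + A * T + eta / 2)
    <= doubled x t y s.
Proof.
move=> tT /andP[s0 sT]; rewrite (le_trans _ (doubled_low x y tT s0))//.
have xy : enorm x <= enorm y + enorm (x - y).
  by rewrite -{1}[x](subrK y) addrC (le_trans (enormD _ _)).
have := ler_wpM2l (ltW C0) xy; have := ler_wpM2l (ltW A0) sT.
have := mulr_ge0 (ltW M0) (sqr_ge0 (t - s)).
have := mulr_ge0 (ltW M0) (sqr_ge0 (enorm (x - y) - Cp / (2 * M))).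
have -> : M * (enorm (x - y) - Cp / (2 * M)) ^+ 2 =
  M * enorm (x - y) ^+ 2 - Cp * enorm (x - y) + Cp ^+ 2 / (4 * M).
  by field; rewrite gt_eqF.
by lra.
Qed.

Lemma doubling_minimum x1 t1 : 0 <= t1 <= T -> doubled x1 t1 x1 t1 < - eta ->
  exists x0 t0 y0 s0, [/\ 0 <= t0 <= T, 0 <= s0 <= T, doubled x0 t0 y0 s0 < - eta &
    forall x t y s, 0 <= t <= T -> 0 <= s <= T ->
      doubled x0 t0 y0 s0 <= doubled x t y s].
Proof.
move=> t1T H1; pose r := (Cp ^+ 2 / (4 * M) + A * T + eta / 2) / (Cp - C).
have mu0 : 0 < Cp - C by rewrite subr_gt0.
have r0 : 0 <= r.
  have k1 : 0 <= Cp ^+ 2 / (4 * M) by rewrite divr_ge0 ?sqr_ge0// mulr_ge0// ltW.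
  have k2 := mulr_ge0 (ltW A0) T0.
  by rewrite divr_ge0 ?(ltW mu0)//; have := eta0; lra.
have far x t y s : 0 <= t <= T -> 0 <= s <= T ->
    r < enorm y + enorm (x - y) -> 0 <= doubled x t y s.
  move=> tT sT; rewrite /r ltr_pdivrMr// => hr.
  have := doubled_coercive x y tT sT; lra.
pose B := [set x : 'rV[R]_n | forall i : 'I_n, `[- r, r]%classic (x 0 i)] `*` `[0, T].
pose K := B `*` B.
have inB x t : 0 <= t <= T -> enorm x <= r -> B (x, t).
  move=> tT xr; split => [i|]; rewrite /= in_itv//= -ler_norml.
  exact: le_trans (coord_le_enorm _ _) xr.
have near x t y s : 0 <= t <= T -> 0 <= s <= T ->
    enorm y + enorm (x - y) <= r -> K ((x, t), (y, s)).
  move=> tT sT hr; split; apply: inB => //.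
    by rewrite (le_trans _ hr)// -{1}[x](subrK y) addrC enormD.
  by rewrite (le_trans _ hr)// lerDl enorm_ge0.
pose F (z : ('rV[R]_n * R) * ('rV[R]_n * R)) :=
  u z.1.1 (Num.max 0 z.1.2) - profile Cp A h z.2.1 z.2.2 + del * z.2.2 +
  M * enorm (z.1.1 - z.2.1) ^+ 2 + M * (z.1.2 - z.2.2) ^+ 2.
have FE x t y s : 0 <= t -> F ((x, t), (y, s)) = doubled x t y s.
  by move=> t0; rewrite /F /= max_r.
have c11 : continuous (fun z : ('rV[R]_n * R) * ('rV[R]_n * R) => z.1.1).
  by apply: continuous_o; exact: continuous_fst.
have c12 : continuous (fun z : ('rV[R]_n * R) * ('rV[R]_n * R) => z.1.2).
  by apply: continuous_o; [exact: continuous_fst|exact: continuous_snd].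
have c21 : continuous (fun z : ('rV[R]_n * R) * ('rV[R]_n * R) => z.2.1).
  by apply: continuous_o; [exact: continuous_snd|exact: continuous_fst].
have c22 : continuous (fun z : ('rV[R]_n * R) * ('rV[R]_n * R) => z.2.2).
  by apply: continuous_o; exact: continuous_snd.
have cF : continuous F.
  move=> z; apply: cvgD; last first.
    apply: cvgM; first exact: cvg_cst.
    move: z; apply: continuous_o (@exprn_continuous _ 2) => z.
    by apply: cvgB; [exact: c12|exact: c22].
  apply: cvgD; last first.
    apply: cvgM; first exact: cvg_cst.
    move: z; apply: continuous_o (@exprn_continuous _ 2).
    apply: continuous_o (@enorm_continuous R n) => z.
    by apply: cvgB; [exact: c11|exact: c21].
  apply: cvgD; last by apply: cvgM; [exact: cvg_cst|exact: c22].
  apply: cvgB.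
    by move: z; apply: continuous_o (continuous_clamped uc); exact: continuous_fst.
  by move: z; apply: continuous_o (@profile_cont _ _ _); exact: continuous_snd.
have [||| [[x0 t0] [y0 s0]] zK mn] := @compact_EVT_min _ R F K.
- exists ((0, 0), (0, 0)); apply: near; rewrite ?lexx//.
  by rewrite subr0 enorm0 addr0.
- apply: compact_setX; apply: compact_setX;
    by [exact: box_compact|exact: segment_compact].
- exact: continuous_subspaceT.
move: zK; rewrite inE => -[[_ /= t0T] [_ /= s0T]].
rewrite !in_itv/= in t0T s0T; have /andP[t00 _] := t0T.
have {}mn x t y s : 0 <= t <= T -> 0 <= s <= T -> enorm y + enorm (x - y) <= r ->
    doubled x0 t0 y0 s0 <= doubled x t y s.
  move=> tT sT hr; rewrite -!FE//; last by case/andP: tT.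
  by apply: mn; rewrite inE; exact: near.
have low : doubled x0 t0 y0 s0 < - eta.
  rewrite (le_lt_trans _ H1)//; apply: mn => //; rewrite leNgt; apply/negP => hr.
  by have := far x1 t1 x1 t1 t1T t1T hr; have := eta0; lra.
exists x0, t0, y0, s0; split=> // x t y s tT sT.
have [hr|hr] := leP (enorm y + enorm (x - y)) r; first exact: mn.
by have := far _ _ _ _ tT sT hr; have := eta0; lra.
Qed.

End Doubling.

(** * Lower bound *)

Lemma complete_square_le (R : realType) (M C d : R) : 0 < M ->
  - (C ^+ 2 / (4 * M)) <= M * d ^+ 2 - C * d.
Proof.
move=> M0; have := mulr_ge0 (ltW M0) (sqr_ge0 (d - C / (2 * M))).
have -> : M * (d - C / (2 * M)) ^+ 2 = M * d ^+ 2 - C * d + C ^+ 2 / (4 * M).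
  by field; rewrite gt_eqF.
lra.
Qed.

Lemma sqr_enormB (R : realType) n (x y : 'rV[R]_n) :
  enorm (x - y) ^+ 2 = enorm x ^+ 2 - 2 * dotv x y + enorm y ^+ 2.
Proof.
by rewrite -!dotvv dotvBl !dotvBr (dotvC y x); ring.
Qed.

(** Young's inequality charges the cross term to lam |p| ^ 2, which the bound on
    kap |q'| can absorb; the rest is of order e. *)
Lemma sqr_enorm_perturb (R : realType) n (p xi : 'rV[R]_n) (k lam e : R) :
  0 <= k -> 0 < lam -> enorm xi ^+ 2 <= 2 * e ->
  `|enorm (p - k *: xi) ^+ 2 - enorm p ^+ 2 - e| <=
  lam * enorm p ^+ 2 + (2 * k ^+ 2 * (lam^-1 + 1) + 1) * e.
Proof.
move=> k0 lam0 xe; have e0 : 0 <= e.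
  by have := sqr_ge0 (enorm xi); lra.
rewrite sqr_enormB dotvZr enormZ (ger0_norm k0) exprMn.
set P := enorm p; set X := enorm xi in xe *.
have c1 : dotv p xi <= P * X := cauchy_schwarz _ _.
have c2 : - dotv p xi <= P * X.
  by rewrite -dotvNl (le_trans (cauchy_schwarz _ _))// -scaleN1r enormZ normrN1 mul1r.
have sq : 2 * k * (P * X) <= lam * P ^+ 2 + k ^+ 2 * X ^+ 2 / lam.
  rewrite -subr_ge0.
  have -> : lam * P ^+ 2 + k ^+ 2 * X ^+ 2 / lam - 2 * k * (P * X) =
    lam * (P - k * X / lam) ^+ 2 by field; rewrite gt_eqF.
  by rewrite mulr_ge0 ?sqr_ge0// ltW.
have b1 : k ^+ 2 * X ^+ 2 <= k ^+ 2 * (2 * e) by rewrite ler_wpM2l ?sqr_ge0.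
have li : 0 <= lam^-1 by rewrite invr_ge0 ltW.
have b2 : k ^+ 2 * X ^+ 2 / lam <= k ^+ 2 * (2 * e) / lam by rewrite ler_wpM2r.
have d1 := ler_wpM2l k0 c1; have d2 := ler_wpM2l k0 c2.
have b3 := mulr_ge0 (sqr_ge0 k) (sqr_ge0 X).
have b4 := mulr_ge0 (mulr_ge0 (sqr_ge0 k) e0) li.
rewrite ler_norml; apply/andP; split; lra.
Qed.

Section Lower.
Context {R : realType} {n : nat}.
Implicit Types (x y b p : 'rV[R]_n) (r s t : R).
Context (g : R -> R) (m1 m2 L : R).
Hypothesis gF : forcing g m1 m2 L.
Local Notation A := (arith_mean g).
Local Notation hm := (harm_mean g).
Context (C Cp T del eta M lam om nu : R).
Hypotheses (C0 : 0 < C) (CCp : C < Cp) (T0 : 0 <= T) (del0 : 0 < del)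
  (eta0 : 0 < eta) (M0 : 0 < M) (lam0 : 0 < lam) (om0 : 0 < om) (nu0 : 0 < nu).
(* The rim of the plateau moves outwards at the speed edge. For any corrector, B
   and B' bound kap |q'| and |q'|, and N is the constant of sqr_enorm_perturb
   for k = 2 (M + 1). *)
Local Notation edge := ((A - hm) / Cp).
Local Notation B := (m2 ^+ 2 / m1).
Local Notation B' := (L * (m2 / m1) / m1).
Local Notation N := (2 * (2 * (M + 1)) ^+ 2 * (lam^-1 + 1) + 1).
Hypothesis M_large : A ^+ 2 + C ^+ 2 <= M * eta.
Hypothesis nu_small : C * nu <= eta / 4.

Context (D eps : R) (u : 'rV[R]_n -> R -> R).
Hypothesis sol : cone_solution g C D eps u.
Hypothesis D_small : D * C * n%:R / nu * T <= eta / 4.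
Hypothesis eps_small : eps <= eta / 4.
Hypothesis eps_om : 2 * eps <= om ^+ 2.
Hypothesis errors_small :
  2 * (M + 1) * om + 2 * D * (M + 1) * n%:R + lam * B + N * D * B' < del / 2.
Hypothesis ratio_small : 8 * m2 * B * edge ^+ 2 * eps <= del ^+ 3 * D.

Let D0 := cone_D_gt0 sol.
Let eps0 := cone_eps_gt0 sol.
Let u_init := cone_init sol.
Let m10 := forcing_m1_gt0 gF.
Let m20 := forcing_m2_gt0 gF.
Let hA := harm_le_arith gF.
Let h0 := harm_mean_gt0 gF.
Let A0 : 0 < A := lt_le_trans h0 hA.
Let Cp0 : 0 < Cp := lt_trans C0 CCp.
Let edge0 : 0 <= edge. Proof. by rewrite divr_ge0 ?subr_ge0 ?hA ?(ltW Cp0). Qed.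

Lemma above_cone x t : 0 <= t <= T -> - C * enorm x - eta / 2 <= u x t.
Proof.
move=> /andP[t0 tT].
have := lower_apriori gF C0 sol x nu0 t0.
have K0 : 0 <= D * C * n%:R / nu.
  by rewrite divr_ge0 ?(ltW nu0)// mulr_ge0// mulr_ge0 ?(ltW D0) ?(ltW C0).
have := ler_wpM2l K0 tT; have := nu_small; have := D_small; lra.
Qed.

Let AC_small : A ^+ 2 / (4 * M) + C ^+ 2 / (4 * M) <= eta / 4.
Proof.
rewrite -mulrDl ler_pdivrMr ?mulr_gt0//.
have -> : eta / 4 * (4 * M) = M * eta by field.
exact: M_large.
Qed.

(** The speed c is always at least harm_mean g, and it is within del / 2 of
    arith_mean g unless the slope X is so small that the plateau bound on tau
    applies. *)
Lemma speed_gap kp c q Gam tau X : corrector g kp c q Gam ->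
  0 <= X -> D / eps * X ^+ 2 <= kp ->
  tau <= A - del -> tau <= hm - del + edge * X -> tau <= c - del / 2.
Proof.
move=> cor X0 Xkp tauA tauh; have kp0 := corrector_kap_gt0 cor.
have [small|large] := leP (edge * X) (del / 2).
  have := corrector_harm_le gF cor; lra.
have /andP[+ _] := corrector_arith gF cor.
suff : m2 * (m2 ^+ 2 / m1) / kp <= del / 2 by lra.
have kX : 0 < edge * X by rewrite (lt_trans _ large)// divr_gt0.
have k0 : 0 < edge by rewrite lt_def edge0 andbT; apply: contraTneq kX => ->; rewrite mul0r ltxx.
rewrite ler_pdivrMr//.
have h1 : del / 2 * (D / eps * X ^+ 2) <= del / 2 * kp by rewrite ler_wpM2l// divr_ge0// ltW.
rewrite (le_trans _ h1)// -(@ler_pM2l _ (edge ^+ 2)) ?exprn_gt0//.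
have -> : edge ^+ 2 * (del / 2 * (D / eps * X ^+ 2)) =
  del / 2 * D / eps * (edge * X) ^+ 2 by ring.
have h2 : (del / 2) ^+ 2 <= (edge * X) ^+ 2.
  by rewrite lerXn2r ?nnegrE ?divr_ge0 ?(ltW kX)// ltW.
have h3 : 0 <= del / 2 * D / eps by rewrite !mulr_ge0 ?invr_ge0// ltW.
rewrite (le_trans _ (ler_wpM2l h3 h2))//.
have -> : del / 2 * D / eps * (del / 2) ^+ 2 = del ^+ 3 * D / (8 * eps).
  by field; rewrite gt_eqF.
rewrite ler_pdivlMr ?mulr_gt0//.
have -> : edge ^+ 2 * (m2 * (m2 ^+ 2 / m1)) * (8 * eps) = 8 * m2 * B * edge ^+ 2 * eps.
  by ring.
exact: ratio_small.
Qed.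

(** Otherwise the doubled function has a minimum (x0, t0, y0, s0) below - eta.
    The corrector is chosen for the slope X = 2 M |x0 - y0| of the paraboloid
    found there. A second minimisation, of eps Gam (u / eps) minus the paraboloid
    lowered by |x - x0| ^ 2 + (t - t0) ^ 2, has its minima within distance
    sqrt (2 eps) of (x0, t0), because eps Gam (u / eps) is within eps of u. So
    close to (x0, t0) the slope has changed too little to be felt, and touching
    yields tau >= c up to small errors, against speed_gap. *)
Lemma lower_bound x1 t1 : 0 <= t1 <= T ->
  profile Cp A hm x1 t1 - del * t1 - eta <= u x1 t1.
Proof.
move=> t1T; rewrite leNgt; apply/negP => bad.
pose Psi := doubled u Cp A hm del M.
have Psi1 : Psi x1 t1 x1 t1 < - eta.
  by rewrite /Psi /doubled !subrr enorm0 expr0n/= mulr0 !addr0; lra.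
have [x0 [t0 [y0 [s0 [t0T s0T Psi0 mn]]]]] :=
  doubling_minimum C0 CCp A0 eta0 M0 T0 (ltW del0) (cone_cont sol) above_cone t1T Psi1.
rewrite -/Psi in Psi0 mn.
have spread x y : - (C ^+ 2 / (4 * M)) <=
    - C * enorm x + Cp * enorm y + M * enorm (x - y) ^+ 2.
  have xy : enorm x <= enorm y + enorm (x - y).
    by rewrite -{1}[x](subrK y) addrC (le_trans (enormD _ _)).
  have := ler_wpM2l (ltW C0) xy; have := complete_square_le C (enorm (x - y)) M0.
  have := ler_wpM2r (enorm_ge0 y) (ltW CCp); lra.
have prof_le y s : profile Cp A hm y s <= - Cp * enorm y + A * s.
  by rewrite /profile ge_min lexx.
have s0p : 0 < s0.
  rewrite ltNge; apply/negP => s0n; have s00 : s0 = 0 by case/andP: s0T => ? _; lra.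
  have s0ge : 0 <= s0 by rewrite s00.
  have := doubled_low Cp A hm M (ltW del0) above_cone x0 y0 t0T s0ge.
  rewrite -/(Psi _ _ _ _) => h1; move: Psi0 h1; rewrite s00 mulr0 => Psi0 h1.
  have := mulr_ge0 (ltW M0) (sqr_ge0 (t0 - 0)); have := spread x0 y0.
  have A2 : 0 <= A ^+ 2 / (4 * M) by rewrite divr_ge0 ?sqr_ge0// mulr_ge0// ltW.
  have := AC_small; have := eta0; lra.
have s0pT : 0 < s0 <= T by rewrite s0p; case/andP: s0T.
set d := enorm (x0 - y0); have d0 : 0 <= d := enorm_ge0 _.
pose tau := - 2 * M * (t0 - s0).
have [tau_A tau_h] : tau <= A - del /\ tau <= hm - del + 2 * M * edge * d.
  apply: (profile_superdifferential Cp0 hA M0 s0pT) => y s sT.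
  by have := mn x0 t0 y s t0T sT; rewrite /Psi /doubled; lra.
pose X := 2 * M * d; have X0 : 0 <= X by rewrite !mulr_ge0// ltW.
(* The additional eps keeps kp positive when the slope vanishes, and alters the
   diffusive term by O(D) only. *)
pose kp := D / eps * (X ^+ 2 + eps).
have De : 0 < D / eps by rewrite divr_gt0.
have kp0 : 0 < kp by rewrite mulr_gt0// ltr_wpDl ?sqr_ge0.
have [c [q [Gam cor]]] := corrector_exists gF kp0.
have q0 := corrector_gt0 cor.
pose dq (z : R) := (c - g z / q z) / kp.
have Xkp : D / eps * X ^+ 2 <= kp by rewrite ler_wpM2l ?(ltW De)// lerDl ltW.
have tau_c : tau <= c - del / 2.
  apply: (speed_gap cor X0 Xkp tau_A).
  by have -> : edge * X = 2 * M * edge * d by rewrite /X; ring.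
have near := scaled_near eps0 (corrector_prim_near cor).
pose w x t := eps * Gam (u x t / eps).
have wu x t : u x t - eps <= w x t <= u x t + eps by rewrite -ler_distl near.
pose f x t := w x t - profile Cp A hm y0 s0 + del * s0 + M * enorm (x - y0) ^+ 2
  + M * (t - s0) ^+ 2 + enorm (x - x0) ^+ 2 + (t - t0) ^+ 2.
have fPsi x t : Psi x t y0 s0 - eps + enorm (x - x0) ^+ 2 + (t - t0) ^+ 2 <= f x t.
  by have := wu x t; rewrite /Psi /doubled /f; lra.
have f0 : f x0 t0 <= Psi x0 t0 y0 s0 + eps.
  have := wu x0 t0; rewrite /Psi /doubled /f !subrr enorm0 expr0n/=; lra.
(* Expanding the squares: f is eps Gam (u / eps) minus quad_test b a th. *)
pose b := (2 * M) *: y0 + 2 *: x0; pose a := - (M + 1).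
pose k0 := profile Cp A hm y0 s0 - del * s0 - M * enorm y0 ^+ 2 - enorm x0 ^+ 2.
pose th t := k0 - M * (t - s0) ^+ 2 - (t - t0) ^+ 2.
pose th' t := - 2 * M * (t - s0) - 2 * (t - t0).
have dth t : is_derive t 1 th (th' t).
  by apply: is_derive_eq; rewrite /th' /GRing.scale/=; ring.
have fE x t : f x t = 1 * (eps * Gam (u x t / eps) - quad_test b a th x t).
  rewrite mul1r quad_testE dotvDl !dotvZl !(dotvC _ x) /f /th /k0 /a -/(w x t).
  by rewrite !sqr_enormB; ring.
suff : - (eps + eta / 4) <= f x0 t0.
  by have := eps_small; have := eta0; lra.
pose M' := C + enorm b + `|f 0 0 + eta / 2 + eps + k0|.
have M1 : 0 < M + 1 by rewrite ltr_wpDr// ltW.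
have [rho rhoP] := affine_le_quadratic M' M1.
apply: (comparison sol q0 (corrector_eq cor) (corrector_prim cor)
  T0 dth fE (rho := rho)) => //.
- move=> x t tT /rhoP hr.
  rewrite [leRHS]fE mul1r quad_testE -/(w x t); rewrite /M' in hr.
  have /andP[wl _] := wu x t; have ul := above_cone x tT.
  have bx : dotv b x <= enorm b * enorm x := cauchy_schwarz _ _.
  have thk : th t <= k0.
    have := mulr_ge0 (ltW M0) (sqr_ge0 (t - s0)); have := sqr_ge0 (t - t0).
    by rewrite /th; lra.
  have := ler_norm (f 0 0 + eta / 2 + eps + k0).
  have := mulr_ge0 (normr_ge0 (f 0 0 + eta / 2 + eps + k0)) (enorm_ge0 x).
  have := enorm_ge0 b; have := C0; rewrite /a; lra.
- move=> x t /andP[tp tT] minf.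
  have xt : 0 <= t <= T by rewrite tT ltW.
  (* As f is within eps of the doubled function plus the added squares, moving
     from (x0, t0) to a minimum of f gains at most 2 eps. *)
  have close : enorm (x - x0) ^+ 2 + (t - t0) ^+ 2 <= 2 * eps.
    have := minf x0 t0 t0T; have := fPsi x t; have := mn x t y0 s0 xt s0T; lra.
  have xclose : enorm (x - x0) ^+ 2 <= 2 * eps by have := sqr_ge0 (t - t0); lra.
  have tclose : `|t - t0| <= om.
    rewrite -(@ler_pXn2r _ 2) ?nnegrE ?(ltW om0)// real_normK ?num_real//.
    by have := sqr_ge0 (enorm (x - x0)); have := eps_om; lra.
  set y := u x t / eps.
  set Q := \sum_(i < n) _.
  pose p := (2 * M) *: (y0 - x0).
  have pE : enorm p = X.
    by rewrite enormZ enormB ger0_norm// mulr_ge0// ltW.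
  have QE : Q = enorm (p - (2 * (M + 1)) *: (x - x0)) ^+ 2.
    rewrite sqr_enorm; apply: eq_bigr => i _; congr (_ ^+ 2).
    by rewrite /b /a /p !mxE; ring.
  have Qclose : `|Q - X ^+ 2 - eps| <= lam * X ^+ 2 + N * eps.
    rewrite QE -pE; apply: sqr_enorm_perturb => //.
    by rewrite mulr_ge0// ltW.
  have dq1 : kp * `|dq y| <= B := corrector_deriv_le1 gF cor y.
  have dq2 : `|dq y| <= B' := corrector_deriv_le2 gF cor y.
  have gqE : g y / q y = c - kp * dq y by rewrite /dq; field; rewrite !gt_eqF// q0.
  have err : `|D / eps * (Q - X ^+ 2 - eps) * dq y| <= lam * B + N * D * B'.
    rewrite normrM [X in X * _]normrM (gtr0_norm De).
    have dn : 0 <= D / eps * `|dq y| by rewrite mulr_ge0// ltW.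
    have h1 := ler_wpM2r dn Qclose.
    have N0 : 0 <= N * D.
      have l1 : 0 <= lam^-1 + 1 by rewrite addr_ge0// invr_ge0 ltW.
      rewrite mulr_ge0 ?(ltW D0)//.
      by have := mulr_ge0 (sqr_ge0 (2 * (M + 1))) l1; lra.
    have h2 := ler_wpM2l N0 dq2.
    have h3 : D / eps * X ^+ 2 * `|dq y| <= B.
      by rewrite (le_trans _ dq1)// ler_wpM2r.
    have h4 := ler_wpM2l (ltW lam0) h3.
    have e1 : N * eps * (D / eps * `|dq y|) = N * D * `|dq y|.
      by field; rewrite !gt_eqF.
    rewrite [leLHS]mulrAC; lra.
  have tht : th' t <= tau + 2 * (M + 1) * om.
    have -> : th' t = tau - 2 * (M + 1) * (t - t0) by rewrite /th' /tau; ring.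
    have h1 : 0 <= 2 * (M + 1) by rewrite mulr_ge0// ltW.
    have := ler_wpM2l h1 tclose.
    by have := ler_norm (- (t - t0)); rewrite normrN => /(ler_wpM2l h1); lra.
  rewrite mul1r -/y -/(dq y) gqE.
  have -> : D / eps * Q * dq y =
    kp * dq y + D / eps * (Q - X ^+ 2 - eps) * dq y by rewrite /kp; ring.
  move: err; rewrite ler_norml => /andP[err _].
  have := errors_small; rewrite /a; lra.
- move=> x; have /andP[wl _] := wu x 0; rewrite u_init in wl.
  have := spread x y0; have := prof_le y0 s0; have := mulr_ge0 (ltW del0) (ltW s0p).
  have := complete_square_le A s0 M0; have := sqr_ge0 (enorm (x - x0)).
  have := sqr_ge0 (0 - t0); have := AC_small.
  by rewrite /f sub0r sqrrN; lra.
Qed.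

End Lower.

(** * Convergence *)

Lemma small_factor (R : realType) (a K c : R) : 0 <= K -> 0 <= a ->
  a <= c / (K + 1) -> a * K <= c.
Proof.
move=> K0 a0; have K1 : 0 < K + 1 by rewrite ltr_wpDl.
by rewrite ler_pdivlMr//; lra.
Qed.

Lemma lipschitz_constant (R : realType) (g : R -> R) : lipschitz g ->
  exists L, forall y z : R, `|g y - g z| <= L * `|y - z|.
Proof.
move=> [M [_ HM]]; exists (M + 1) => y z.
have M1 : M < M + 1 by rewrite ltrDl.
by have := HM _ M1 (y, z); apply.
Qed.

Lemma positive_periodic_bounds (R : realType) (g : R -> R) : continuous g ->
  periodic g -> (forall y, 0 < g y) ->
  exists m1 m2, 0 < m1 /\ forall y, m1 <= g y <= m2.
Proof.
move=> cg pg g0; have [z gz] := periodic_argmax cg pg.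
have [||t gt] := @periodic_argmax _ (fun y => - g y).
- by move=> x; apply: cvgN; exact: cg.
- by move=> x k; rewrite pg.
by exists (g t), (g z); split=> // y; rewrite -lerN2 gt gz.
Qed.

Lemma compact_bounds (R : realType) n (K : set ('rV[R]_n * R)) : compact K ->
  exists rho T, 0 <= rho /\ 0 <= T /\ forall p, K p -> enorm p.1 <= rho /\ p.2 <= T.
Proof.
move=> cK; have [->|/set0P K0] := eqVneq K set0; first by exists 0, 0.
have [|p _ Hp] := compact_EVT_max K0 cK (f := fun p => enorm p.1).
  apply: continuous_subspaceT.
  by apply: continuous_o (@enorm_continuous R n); exact: continuous_fst.
have [|q _ Hq] := compact_EVT_max K0 cK (f := snd).
  by apply: continuous_subspaceT; exact: continuous_snd.
exists (enorm p.1), (Num.max 0 q.2); rewrite enorm_ge0 le_max lexx; split=> //; split=> //.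
move=> r Kr; split; first by apply: Hp; rewrite inE.
by rewrite le_max; apply/orP; right; apply: Hq; rewrite inE.
Qed.

Section Convergence.
Context {R : realType} {n : nat}.
Context (g : R -> R) (m1 m2 L : R).
Hypothesis gF : forcing g m1 m2 L.
Local Notation A := (arith_mean g).
Local Notation hm := (harm_mean g).
Context (alpha C : R) (u0 : 'rV[R]_n -> R) (u : R -> 'rV[R]_n -> R -> R).
Hypotheses (alpha01 : 0 < alpha < 1) (C0 : 0 < C).
Hypothesis u0E : forall x, u0 x = - C * enorm x.
Hypothesis hu : forall eps : R, 0 < eps -> is_solution g alpha eps u0 (u eps).

Let sol eps : 0 < eps -> cone_solution g C (eps `^ alpha) eps (u eps).
Proof.
move=> eps0; have [reg cont eq init growth] := hu eps0.
have half : 0 < (2^-1 : R) < 1 by rewrite invr_gt0 ltr0n invf_lt1// ltr1n.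
have [deriv _ _ _ _] := reg _ half.
split=> //; first exact: powR_gt0.
- move=> x t /(deriv x t)[d1 d2 d3].
  by split=> [||i]; [exact: d1|exact: d2|exact: d3].
- by move=> x; rewrite init.
Qed.

Lemma upper_limit eps x t : 0 < eps -> 0 <= t ->
  u eps x t <= profile C A hm x t + 2 * eps.
Proof.
move=> eps0 t0; rewrite -lerBlDr /profile le_min !lerBlDr.
rewrite (upper_arithmetic gF C0 (sol eps0))//=.
by rewrite (upper_harmonic gF C0 (sol eps0)).
Qed.

Lemma near_powR_le (a d : R) : 0 < a -> 0 < d -> \forall eps \near 0^'+, eps `^ a <= d.
Proof.
move=> a0 d0; have /cvgrPdist_lt /(_ _ d0) := powR_cvg0 a0.
apply: filterS => eps; rewrite sub0r normrN => /ltW; apply: le_trans.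
exact: ler_norm.
Qed.

(** The parameters are fixed in the order Cp, del, eta, M, lam, om, nu. It then
    remains that eps, D = eps `^ alpha and eps / D = eps `^ (1 - alpha) be small:
    this is where 0 < alpha < 1 enters. *)
Lemma lower_limit (e rho T : R) : 0 < e -> 0 <= rho -> 0 <= T ->
  \forall eps \near 0^'+, forall x t, enorm x <= rho -> 0 <= t <= T ->
    profile C A hm x t - e <= u eps x t.
Proof.
move=> e0 rho0 T0.
have m10 := forcing_m1_gt0 gF; have m20 := forcing_m2_gt0 gF.
have L0 := forcing_L_ge0 gF.
pose B := m2 ^+ 2 / m1; pose B' := L * (m2 / m1) / m1.
have B0 : 0 < B by rewrite divr_gt0 ?exprn_gt0.
have B'0 : 0 <= B' by rewrite /B' !mulr_ge0 ?invr_ge0 ?(ltW m10) ?(ltW m20).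
pose Cp := C + e / (4 * (rho + 1)); pose del := e / (4 * (T + 1)); pose eta := e / 4.
have r1 : 0 < rho + 1 by rewrite ltr_wpDl.
have T1 : 0 < T + 1 by rewrite ltr_wpDl.
have mu0 : 0 < e / (4 * (rho + 1)) by rewrite divr_gt0// mulr_gt0.
have CCp : C < Cp by rewrite ltrDl.
have del0 : 0 < del by rewrite divr_gt0// mulr_gt0.
have eta0 : 0 < eta by rewrite divr_gt0.
(* M makes the doubling penalty cost at most a fraction of eta; lam, om and the
   bounds on D below give each error term of lower_bound the share del / 8. *)
pose M := (A ^+ 2 + C ^+ 2) / eta.
have M0 : 0 < M by rewrite divr_gt0// ltr_wpDl ?sqr_ge0// exprn_gt0.
have M1 : 0 < M + 1 by rewrite ltr_wpDl// ltW.
pose lam := del / (8 * B); pose om := del / (16 * (M + 1)); pose nu := eta / (4 * C).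
have lam0 : 0 < lam by rewrite divr_gt0// mulr_gt0.
have om0 : 0 < om by rewrite divr_gt0// mulr_gt0.
have nu0 : 0 < nu by rewrite divr_gt0// mulr_gt0.
pose N := 2 * (2 * (M + 1)) ^+ 2 * (lam^-1 + 1) + 1.
have N0 : 0 <= N.
  have l1 : 0 <= lam^-1 + 1 by rewrite addr_ge0// invr_ge0 ltW.
  by have := mulr_ge0 (sqr_ge0 (2 * (M + 1))) l1; rewrite /N; lra.
pose edge := (A - hm) / Cp.
pose K1 := C * n%:R / nu * T.
pose K2 := 2 * (M + 1) * n%:R + N * B'.
pose K3 := 8 * m2 * B * edge ^+ 2.
have K10 : 0 <= K1 by rewrite /K1 !mulr_ge0 ?invr_ge0 ?(ltW C0) ?(ltW nu0).
have K20 : 0 <= K2.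
  by rewrite /K2 addr_ge0// mulr_ge0// mulr_ge0// ltW.
have K30 : 0 <= K3.
  by rewrite /K3 mulr_ge0 ?sqr_ge0// mulr_ge0 ?(ltW B0)// mulr_ge0// ltW.
have pos c K : 0 < c -> 0 <= K -> 0 < c / (K + 1).
  by move=> c0 KK; rewrite divr_gt0// ltr_wpDl.
have /andP[al0 al1] := alpha01; have al1' : 0 < 1 - alpha by rewrite subr_gt0.
near=> eps => x t xrho tT.
have eps0 : 0 < eps by near: eps; exact: nbhs_right_gt.
have eps_eta : eps <= eta / 4 by near: eps; apply: nbhs_right_le; rewrite divr_gt0.
have eps_om : eps <= om ^+ 2 / 2.
  by near: eps; apply: nbhs_right_le; rewrite divr_gt0// exprn_gt0.
have D_K1 : eps `^ alpha <= eta / 4 / (K1 + 1).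
  by near: eps; apply: near_powR_le => //; apply: pos => //; rewrite divr_gt0.
have D_K2 : eps `^ alpha <= del / 8 / (K2 + 1).
  by near: eps; apply: near_powR_le => //; apply: pos => //; rewrite divr_gt0.
have D_K3 : eps `^ (1 - alpha) <= del ^+ 3 / (K3 + 1).
  by near: eps; apply: near_powR_le => //; apply: pos => //; rewrite exprn_gt0.
set D := eps `^ alpha in D_K1 D_K2.
have D0 : 0 < D by rewrite powR_gt0.
have epsE : eps = eps `^ (1 - alpha) * D.
  rewrite /D -powRD; last by apply/implyP => _; rewrite gt_eqF.
  by rewrite subrK powRr1// ltW.
have h1 := small_factor K10 (ltW D0) D_K1.
have h2 := small_factor K20 (ltW D0) D_K2.
have h3 := small_factor K30 (powR_ge0 _ _) D_K3.
have c1 : A ^+ 2 + C ^+ 2 <= M * eta by rewrite /M divfK// gt_eqF.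
have c2 : C * nu <= eta / 4.
  by rewrite le_eqVlt; apply/orP; left; apply/eqP; rewrite /nu; field; rewrite gt_eqF.
have c3 : D * C * n%:R / nu * T <= eta / 4 by move: h1; rewrite /K1; lra.
have c4 : 2 * eps <= om ^+ 2 by lra.
have c5 : 2 * (M + 1) * om + 2 * D * (M + 1) * n%:R + lam * B + N * D * B' < del / 2.
  have -> : 2 * (M + 1) * om = del / 8 by rewrite /om; field; rewrite gt_eqF.
  have -> : lam * B = del / 8 by rewrite /lam; field; rewrite gt_eqF.
  move: h2; rewrite /K2; lra.
have c6 : 8 * m2 * B * edge ^+ 2 * eps <= del ^+ 3 * D.
  by have := ler_wpM2r (ltW D0) h3; rewrite mulrAC -epsE mulrC.
have := lower_bound gF C0 CCp T0 del0 eta0 M0 lam0 om0 nu0 c1 c2 (sol eps0)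
  c3 eps_eta c4 c5 c6 x tT.
apply: le_trans.
have d1 : del * t <= e / 4.
  have /andP[_ tT'] := tT.
  have h := ler_wpM2l (ltW del0) tT'.
  rewrite (le_trans h)// /del mulrAC ler_pdivrMr ?mulr_gt0//.
  by lra.
have d2 : e / (4 * (rho + 1)) * enorm x <= e / 4.
  rewrite (le_trans (ler_wpM2l (ltW mu0) xrho))// mulrAC ler_pdivrMr ?mulr_gt0//.
  by lra.
have d3 : profile C A hm x t - e / 4 <= profile Cp A hm x t.
  have p1 : profile C A hm x t <= - C * enorm x + A * t by rewrite /profile ge_min lexx.
  have p2 : profile C A hm x t <= hm * t by rewrite /profile ge_min lexx orbT.
  rewrite {2}/profile le_min /Cp; apply/andP; split; lra.
rewrite /eta; lra.
Unshelve. all: by end_near. Qed.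

End Convergence.

Theorem proposition5p7 (R : realType) (n : nat) (hn : (0 < n)%N)
    (g : R -> R) (g_lip : lipschitz g)
    (g_per : forall (y : R) (k : int), g (y + k%:~R) = g y)
    (g_pos : forall y : R, 0 < g y)
    (alpha : R) (halpha : 0 < alpha < 1)
    (C : R) (hC : 0 < C)
    (u0 : 'rV[R]_n -> R) (hu0 : forall x, u0 x = - C * enorm x)
    (u : R -> 'rV[R]_n -> R -> R)
    (hu : forall eps : R, 0 < eps -> is_solution g alpha eps u0 (u eps)) :
  cvg_locally_uniformly u 0^'+
    (fun x t => Num.min
       (u0 x + t * \int[lebesgue_measure]_(s in `[0%R, 1%R]) g s)
       (t * (\int[lebesgue_measure]_(s in `[0%R, 1%R]) (g s)^-1)^-1)).
Proof.
have [L gL] := lipschitz_constant g_lip.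
have cg : continuous g := lipschitz_cont gL.
have [m1 [m2 [m10 gb]]] := positive_periodic_bounds cg g_per g_pos.
have gF : forcing g m1 m2 L by split.
have vE x t : Num.min (u0 x + t * arith_mean g) (t * harm_mean g) =
    profile C (arith_mean g) (harm_mean g) x t.
  by rewrite /profile hu0 [arith_mean g * t]mulrC [harm_mean g * t]mulrC.
move=> K cK K0.
have [rho [T [rho0 [T0 KrT]]]] := compact_bounds cK.
move=> P /uniform_nbhs[E [[e /= e0 eE] EP]].
have e20 : 0 < e / 2 by rewrite divr_gt0.
have low := lower_limit gF halpha hC hu0 hu e20 rho0 T0.
suff : \forall eps \near 0^'+, forall p, K p ->
    `|profile C (arith_mean g) (harm_mean g) p.1 p.2 - u eps p.1 p.2| < e.
  apply: filterS => eps H1; apply: EP => p Kp; apply: eE.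
  by rewrite /ball_/= [X in X - _]vE; exact: H1.
near=> eps => p Kp.
have p20 : 0 <= p.2 := K0 p Kp.
have [pr pT] := KrT p Kp.
have eps0 : 0 < eps by near: eps; exact: nbhs_right_gt.
have eps4 : eps < e / 4 by near: eps; apply: nbhs_right_lt; rewrite divr_gt0.
have h1 : profile C (arith_mean g) (harm_mean g) p.1 p.2 - e / 2 <= u eps p.1 p.2.
  move: {eps0 eps4} p Kp p20 pr pT => p _ p20 pr pT.
  by have := near low eps; apply; rewrite ?p20.
have h2 := upper_limit gF hC hu0 hu p.1 eps0 p20.
by rewrite ltr_norml; lra.
Unshelve. all: by end_near. Qed.
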